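(* Let $n\in\mathbb{N}$ and let $\mathfrak{g}=\mathfrak{g}_{\overline 0}\oplus\mathfrak{g}_{\overline 1}$ be a classical Lie superalgebra over $k$ such that there are only finitely many (isomorphism classes of) simple modules of dimension $\le n$ in $\mathcal{F}_{(\mathfrak{g},\mathfrak{g}_{\overline 0})}$. Then there are only finitely many isomorphism classes of endotrivial modules in $\mathcal{F}_{(\mathfrak{g},\mathfrak{g}_{\overline 0})}$ of dimension $n$.
   Context: $k$ is an algebraically closed field of characteristic $0$. All modules are $\mathbb{Z}_2$-graded (supermodules), and homomorphisms are homogeneous of degree $\overline 0$. A finite dimensional Lie superalgebra $\mathfrak{g}$ is classical if there is a connected reductive algebraic group $G_{\overline 0}$ with $\mathrm{Lie}(G_{\overline 0})=\mathfrak{g}_{\overline 0}$ and an action of $G_{\overline 0}$ on $\mathfrak{g}_{\overline 1}$ which differentiates to the adjoint action of $\mathfrak{g}_{\overline 0}$ on $\mathfrak{g}_{\overline 1}$; in particular $\mathfrak{g}_{\overline 0}$ is reductive. $\mathcal{F}_{(\mathfrak{g},\mathfrak{g}_{\overline 0})}$ is the full subcategory of $\mathfrak{g}$-supermodules whose objects are the finite dimensional supermodules that are completely reducible over $\mathfrak{g}_{\overline 0}$. $k_{ev}$ is the trivial supermodule concentrated in degree $\overline 0$. $M\in\mathcal{F}_{(\mathfrak{g},\mathfrak{g}_{\overline 0})}$ is endotrivial if $M\otimes M^*\cong k_{ev}\oplus P$ with $P$ projective in $\mathcal{F}_{(\mathfrak{g},\mathfrak{g}_{\overline 0})}$. *)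

(* Defs.v *)
From HB Require Import structures.
From mathcomp Require Import all_boot all_order all_algebra.
From mathcomp Require Import mpoly.

Set Implicit Arguments.
Unset Strict Implicit.
Unset Printing Implicit Defensive.

Import GRing.Theory passmx.
Local Open Scope ring_scope.

Lemma linfun_linE (k : fieldType) (U V : vectType k) (f : U -> V) :
  linear f -> linfun f =1 f.
Proof.
move=> fl v; pose F : {linear U -> V} := HB.pack f (GRing.isLinear.Build _ _ _ _ f fl).
exact: (lfunE F).
Qed.

(* Parities are booleans: [false] is even, [true] is odd, and addition in Z_2
   is the exclusive or [(+)]. *)
Record superspace (k : fieldType) := Superspace {
  sspace_sort :> vectType k;
  gr : bool -> {vspace sspace_sort};
  gr_full : (gr false + gr true = fullv)%VS;
  gr_cap : (gr false :&: gr true = 0)%VS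
}.
Arguments gr {k} s _.

Section SuperspaceTheory.
Variables (k : fieldType) (V : superspace k).
Implicit Types (a b : bool) (v : V).

Definition pr a : 'End(V) := daddv_pi (gr V a) (gr V (~~ a)).

(* v |-> (-1)^|v| v *)
Definition par : 'End(V) := pr false - pr true.

Lemma gr_capN a : (gr V a :&: gr V (~~ a) = 0)%VS.
Proof. by case: a; rewrite /= ?gr_cap // capvC gr_cap. Qed.

Lemma pr_gr a v : pr a v \in gr V a.
Proof. exact: memv_pi. Qed.

Lemma pr_id a v : v \in gr V a -> pr a v = v.
Proof. exact/daddv_pi_id/gr_capN. Qed.

Lemma pr_sum v : pr false v + pr true v = v.
Proof. by rewrite /pr daddv_pi_add ?gr_cap // gr_full memvf. Qed.

Lemma pr_gr_if a b v : v \in gr V b -> pr a v = if a == b then v else 0.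
Proof.
move=> vb; case: eqP => [->|/eqP nab]; first exact: pr_id.
have {nab}-> : a = ~~ b by case: a b nab {vb} => [] [].
by apply: (addrI (pr b v)); rewrite addr0 (pr_id vb) -[RHS]pr_sum;
  case: (b) vb => vb; rewrite (pr_id vb) // addrC.
Qed.

Lemma par_gr b v : v \in gr V b -> par v = (-1) ^+ b *: v.
Proof.
move=> vb; rewrite /par add_lfunE opp_lfunE !(pr_gr_if _ vb).
by case: b vb => _ /=; rewrite ?expr0 ?expr1 ?scaleN1r ?scale1r ?sub0r ?subr0.
Qed.

Definition graded (U : {vspace V}) := forall a v, v \in U -> pr a v \in U.

End SuperspaceTheory.
Arguments pr {k} V a.
Arguments par {k} V.

(* The superspace whose parity a part is the image of the projection e a. *)
Section ProjSuperspace.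
Variables (k : fieldType) (V : vectType k) (e : bool -> 'End(V)).
Hypothesis eM : forall a b v, e a (e b v) = if a == b then e b v else 0.
Hypothesis eS : forall v, e false v + e true v = v.

Lemma proj_mem a v : (v \in limg (e a)) = (e a v == v).
Proof.
apply/idP/eqP => [/memv_imgP[u _ ->]|<-]; first by rewrite eM eqxx.
exact/memv_img/memvf.
Qed.

Fact proj_full : (limg (e false) + limg (e true) = fullv)%VS.
Proof.
apply/vspaceP => v; rewrite memvf -[v]eS.
by apply: memv_add; apply/memv_img/memvf.
Qed.

Fact proj_cap : (limg (e false) :&: limg (e true) = 0)%VS.
Proof.
apply/eqP; rewrite -subv0; apply/subvP => v; rewrite memv_cap !proj_mem memv0.
by case/andP => /eqP <- /eqP; rewrite eM /= => <-.
Qed.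

Definition proj_superspace : superspace k :=
  @Superspace k V (fun a => limg (e a)) proj_full proj_cap.
End ProjSuperspace.

Record lieSuperalg (k : fieldType) := LieSuperalg {
  lsa_space :> superspace k;
  br : 'Hom(lsa_space, 'End(lsa_space));
  br_gr : forall a b x y, x \in gr lsa_space a -> y \in gr lsa_space b ->
    br x y \in gr lsa_space (a (+) b);
  br_anti : forall a b x y, x \in gr lsa_space a -> y \in gr lsa_space b ->
    br x y = - ((-1) ^+ (a && b) *: br y x);
  br_jacobi : forall a b x y z, x \in gr lsa_space a -> y \in gr lsa_space b ->
    br x (br y z) = br (br x y) z + (-1) ^+ (a && b) *: br y (br x z)
}.
Arguments br {k} l.

Record smod (k : fieldType) (g : lieSuperalg k) := Smod {
  smod_space :> superspace k;
  act : 'Hom(g, 'End(smod_space));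
  act_gr : forall a b x m, x \in gr g a -> m \in gr smod_space b ->
    act x m \in gr smod_space (a (+) b);
  act_br : forall a b x y m, x \in gr g a -> y \in gr g b ->
    act (br g x y) m = act x (act y m) - (-1) ^+ (a && b) *: act y (act x m)
}.
Arguments act {k g} s.

Section Modules.
Variables (k : fieldType) (g : lieSuperalg k).
Implicit Types (M N P : smod g).

Definition is_shom M N (f : 'Hom(M, N)) :=
  (forall a m, m \in gr M a -> f m \in gr N a) /\
  (forall x m, f (act M x m) = act N x (f m)).

Definition sisom M N := exists (f : 'Hom(M, N)) (h : 'Hom(N, M)),
  [/\ is_shom f, is_shom h, (h \o f)%VF = \1%VF & (f \o h)%VF = \1%VF].

Definition is_submod M (U : {vspace M}) :=
  graded U /\ forall x u, u \in U -> act M x u \in U.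

(* sub-supermodules of the restriction of M to the even part of g *)
Definition is_submod0 M (U : {vspace M}) :=
  graded U /\ forall x u, x \in gr g false -> u \in U -> act M x u \in U.

Definition is_simple M :=
  (fullv : {vspace M}) <> 0%VS /\
  forall U : {vspace M}, is_submod U -> U = 0%VS \/ U = fullv.

Definition in_F M := forall U : {vspace M}, is_submod0 U ->
  exists W : {vspace M}, [/\ is_submod0 W, (U + W = fullv)%VS & (U :&: W = 0)%VS].

(* F is closed under subquotients, so its epimorphisms are the surjections. *)
Definition projective P := in_F P /\
  forall M N (f : 'Hom(M, N)) (h : 'Hom(P, N)), in_F M -> in_F N ->
  is_shom f -> limg f = fullv -> is_shom h ->
  exists2 h' : 'Hom(P, M), is_shom h' & (f \o h')%VF = h.

Definition finitely_many (C : smod g -> Prop) :=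
  exists (m : nat) (L : 'I_m -> smod g), forall M, C M -> exists i, sisom M (L i).

End Modules.

Section Trivial.
Variables (k : fieldType) (g : lieSuperalg k).

Definition kev_gr (a : bool) : {vspace k^o} := if a then 0%VS else fullv.
Fact kev_full : (kev_gr false + kev_gr true = fullv)%VS.
Proof. exact: addv0. Qed.
Fact kev_cap : (kev_gr false :&: kev_gr true = 0)%VS.
Proof. exact: capv0. Qed.
Definition kev_space := Superspace kev_full kev_cap.

Fact kev_act_gr (a b : bool) (x : g) (m : kev_space) :
  x \in gr g a -> m \in gr kev_space b ->
  (0 : 'Hom(g, 'End(kev_space))) x m \in gr kev_space (a (+) b).
Proof. by move=> _ _; rewrite !zero_lfunE mem0v. Qed.
Fact kev_act_br (a b : bool) (x y : g) (m : kev_space) :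
  x \in gr g a -> y \in gr g b ->
  let T := (0 : 'Hom(g, 'End(kev_space))) in
  T (br g x y) m = T x (T y m) - (-1) ^+ (a && b) *: T y (T x m).
Proof. by move=> _ _ /=; rewrite !zero_lfunE scaler0 subr0. Qed.
Definition kev : smod g := Smod kev_act_gr kev_act_br.
End Trivial.

Section DirectSum.
Variables (k : fieldType) (g : lieSuperalg k) (M N : smod g).

Definition pmap (A : 'End(M)) (B : 'End(N)) : 'End((M * N)%type) :=
  linfun (fun u : M * N => (A u.1, B u.2)).
Lemma pmapE A B u v : pmap A B (u, v) = (A u, B v).
Proof.
by rewrite linfun_linE // => c [p q] [r s] /=; rewrite !linearP.
Qed.

Definition dsum_proj a : 'End((M * N)%type) := pmap (pr M a) (pr N a).
Fact dsum_projM a b v :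
  dsum_proj a (dsum_proj b v) = if a == b then dsum_proj b v else 0.
Proof.
case: v => u v; rewrite /dsum_proj !pmapE.
by rewrite !(@pr_gr_if _ _ a b) ?pr_gr //; case: eqP.
Qed.
Fact dsum_projS v : dsum_proj false v + dsum_proj true v = v.
Proof. by case: v => u v; rewrite !pmapE -[in RHS](pr_sum u) -[in RHS](pr_sum v). Qed.
Definition dsum_space := proj_superspace dsum_projM dsum_projS.

Lemma mem_dsum a u v :
  ((u, v) \in gr dsum_space a) = (u \in gr M a) && (v \in gr N a).
Proof.
rewrite (proj_mem dsum_projM) pmapE xpair_eqE.
by congr (_ && _); apply/eqP/idP => [<-|/pr_id //]; apply: pr_gr.
Qed.

Definition dsum_act : 'Hom(g, 'End(dsum_space)) :=
  linfun (fun x => pmap (act M x) (act N x)).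
Lemma dsum_actE x u v : dsum_act x (u, v) = (act M x u, act N x v).
Proof.
rewrite linfun_linE ?pmapE // => c y z; apply/lfunP => -[p q].
by rewrite !lfunE /= !lfunE /= !pmapE !linearP !add_lfunE !scale_lfunE.
Qed.

Fact dsum_act_gr a b x m : x \in gr g a -> m \in gr dsum_space b ->
  dsum_act x m \in gr dsum_space (a (+) b).
Proof.
case: m => u v xa; rewrite dsum_actE !mem_dsum => /andP[ub vb].
by rewrite !act_gr.
Qed.
Fact dsum_act_br a b x y m : x \in gr g a -> y \in gr g b ->
  dsum_act (br g x y) m = dsum_act x (dsum_act y m)
    - (-1) ^+ (a && b) *: dsum_act y (dsum_act x m).
Proof.
case: m => u v xa yb; rewrite !dsum_actE.
by rewrite !(act_br _ xa yb).
Qed.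
Definition dsum : smod g := Smod dsum_act_gr dsum_act_br.
End DirectSum.

Section Dual.
Variables (k : fieldType) (g : lieSuperalg k) (M : smod g).

Definition dvec : vectType k := 'Hom(M, k^o).

Definition dual_proj a : 'End(dvec) := linfun (fun f : dvec => (f \o pr M a)%VF).
Lemma dual_projE a (f : dvec) : dual_proj a f = (f \o pr M a)%VF.
Proof.
rewrite linfun_linE // => c p q; apply/lfunP => v.
by rewrite !lfunE /= !lfunE /= !lfunE.
Qed.
Fact dual_projM a b f :
  dual_proj a (dual_proj b f) = if a == b then dual_proj b f else 0.
Proof.
rewrite !dual_projE; apply/lfunP => v; rewrite !comp_lfunE.
rewrite (@pr_gr_if _ _ b a) ?pr_gr // eq_sym.
by case: eqP => [->|_]; rewrite ?comp_lfunE // linear0 lfunE.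
Qed.
Fact dual_projS f : dual_proj false f + dual_proj true f = f.
Proof.
apply/lfunP => v; rewrite !dual_projE add_lfunE !comp_lfunE.
by rewrite -[in RHS](pr_sum v) [RHS]linearD.
Qed.
Definition dual_space := proj_superspace dual_projM dual_projS.

Lemma mem_dual a (f : dvec) :
  reflect (forall v, v \in gr M (~~ a) -> f v = 0) (f \in gr dual_space a).
Proof.
rewrite (proj_mem dual_projM) dual_projE.
apply: (iffP eqP) => [<- v va|f0].
  by rewrite comp_lfunE (pr_gr_if _ va); case: (a); rewrite linear0.
apply/lfunP => v; rewrite comp_lfunE -[v in RHS]pr_sum linearD.
by case: a f0 => f0 /=; rewrite (f0 _ (pr_gr _ _)) ?add0r ?addr0.
Qed.

Definition dual_act_fun (x : g) (f : dvec) : dvec :=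
  - (f \o act M (pr g false x))%VF - (f \o par M \o act M (pr g true x))%VF.
Definition dual_act : 'Hom(g, 'End(dual_space)) :=
  linfun (fun x => linfun (dual_act_fun x) : 'End(dual_space)).

Lemma dual_act_funE x f : dual_act x f = dual_act_fun x f.
Proof.
have lin_f z : linear (dual_act_fun z).
  move=> c p q; apply/lfunP => v.
  rewrite /dual_act_fun !(add_lfunE, opp_lfunE, scale_lfunE, comp_lfunE).
  by rewrite !scalerDr !scalerN !opprD addrACA.
rewrite linfun_linE; first exact: linfun_linE.
move=> c y z; apply/lfunP => h; rewrite add_lfunE scale_lfunE !linfun_linE //.
apply/lfunP => v; rewrite /dual_act_fun; move: (par M) => p.
do 3!rewrite ?(linearP, add_lfunE, opp_lfunE, scale_lfunE, comp_lfunE) /=.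
by rewrite !scalerDr !scalerN addrACA.
Qed.

(* the defining formula (x f)(v) = - (-1)^(|x||f|) f(x v) *)
Lemma dual_actE a b x (f : dual_space) v : x \in gr g a -> f \in gr dual_space b ->
  (dual_act x f : dvec) v = - ((-1) ^+ (a && b) *: (f : dvec) (act M x v)).
Proof.
move=> xa fb; rewrite dual_act_funE /dual_act_fun.
rewrite add_lfunE 2!opp_lfunE 3!comp_lfunE !(pr_gr_if _ xa).
have fpar u : (f : dvec) (par M u) = (-1) ^+ b *: (f : dvec) u.
  have E c : (f : dvec) (par M (pr M c u)) = (-1) ^+ b *: (f : dvec) (pr M c u).
    rewrite (par_gr (pr_gr _ _)) linearZ /=.
    have [->//|ncb] := eqVneq c b.
    rewrite (mem_dual _ _ fb) ?scaler0 //.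
    by have -> : ~~ b = c; [case: c b ncb {fb} => [] [] | exact: pr_gr].
  by rewrite -[u]pr_sum !linearD /= ?scalerDr; congr (_ + _); apply: E.
rewrite fpar; case: a xa => /= _; rewrite !linear0 zero_lfunE !linear0.
  by rewrite sub0r.
by rewrite addr0 expr0 scale1r.
Qed.

Fact dual_act_gr a b x m : x \in gr g a -> m \in gr dual_space b ->
  dual_act x m \in gr dual_space (a (+) b).
Proof.
move=> xa mb; apply/mem_dual => v va; rewrite (dual_actE _ xa mb).
rewrite (mem_dual _ _ mb) ?scaler0 ?oppr0 //.
have -> : ~~ b = a (+) ~~ (a (+) b) by case: (a) (b) => [] [].
exact: act_gr.
Qed.

Fact dual_act_br a b x y m : x \in gr g a -> y \in gr g b ->
  dual_act (br g x y) m = dual_act x (dual_act y m)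
    - (-1) ^+ (a && b) *: dual_act y (dual_act x m).
Proof.
move=> xa yb.
have H c (f : dual_space) : f \in gr dual_space c ->
  dual_act (br g x y) f = dual_act x (dual_act y f)
    - (-1) ^+ (a && b) *: dual_act y (dual_act x f).
  move=> fc; apply/lfunP => v.
  rewrite add_lfunE opp_lfunE scale_lfunE.
  rewrite (dual_actE _ (br_gr xa yb) fc).
  rewrite (dual_actE _ xa (dual_act_gr yb fc)) (dual_actE _ yb (dual_act_gr xa fc)).
  rewrite (dual_actE _ xa fc) (dual_actE _ yb fc) (act_br _ xa yb) linearB linearZ /=.
  rewrite !scalerN !opprK scalerBr opprB linearZ /= !scalerA -!signr_addb.
  by congr (_ *: _ - _ *: _); congr (_ ^+ _); case: (a) (b) (c) => [] [] [].
by rewrite -[m]pr_sum !linearD /= !(H _ _ (pr_gr _ _)) addrACA -opprD -scalerDr.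
Qed.
Definition sdual : smod g := Smod dual_act_gr dual_act_br.
End Dual.

(* V (x) W is the space of matrices indexed by bases of V and W; the matrix
   unit in position (i, j) is the tensor of the i-th and j-th basis vectors.
   [tpure_bilinear] and [tens_universal] give the universal property. *)
Section Tensor.
Variables (k : fieldType) (V W : vectType k).

Definition tens : vectType k := 'M[k]_(\dim {:V}, \dim {:W}).

Definition tpure (v : V) (w : W) : tens :=
  (rVof (vbasis {:V}) v)^T *m rVof (vbasis {:W}) w.

(* A (x) B *)
Definition tmap (A : 'End(V)) (B : 'End(W)) : 'End(tens) :=
  linfun (fun T : tens =>
    (mxof (vbasis {:V}) (vbasis {:V}) A)^T *m T
      *m mxof (vbasis {:W}) (vbasis {:W}) B).

Lemma tpure_bilinear :
  (forall w, linear (tpure^~ w)) /\ (forall v, linear (tpure v)).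
Proof.
split=> [w|v] c p q; rewrite /tpure !linearP /=; last by [].
by rewrite mulmxDl scalemxAl.
Qed.

Lemma tpureDl v v' w : tpure (v + v') w = tpure v w + tpure v' w.
Proof. by rewrite /tpure !linearD /= mulmxDl. Qed.
Lemma tpureDr v w w' : tpure v (w + w') = tpure v w + tpure v w'.
Proof. by rewrite /tpure !linearD /=. Qed.
Lemma tpureZl c v w : tpure (c *: v) w = c *: tpure v w.
Proof. by rewrite /tpure !linearZ /= scalemxAl. Qed.
Lemma tpureZr c v w : tpure v (c *: w) = c *: tpure v w.
Proof. by rewrite /tpure !linearZ /=. Qed.
Lemma tpure0l w : tpure 0 w = 0.
Proof. by rewrite -[0 in LHS](scale0r 0) tpureZl scale0r. Qed.
Lemma tpure0r v : tpure v 0 = 0.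
Proof. by rewrite -[0 in LHS](scale0r 0) tpureZr scale0r. Qed.

Lemma tpure_basis (i : 'I_(\dim {:V})) (j : 'I_(\dim {:W})) :
  tpure (vbasis {:V})`_i (vbasis {:W})`_j = delta_mx i j.
Proof.
by rewrite /tpure !(rVofE (vbasisP _)) trmx_delta mul_delta_mx.
Qed.

Lemma tens_ext (U : vectType k) (f h : 'Hom(tens, U)) :
  (forall v w, f (tpure v w) = h (tpure v w)) -> f = h.
Proof.
move=> fh; apply/lfunP => T; rewrite [T]matrix_sum_delta !linear_sum.
apply: eq_bigr => i _; rewrite !linear_sum; apply: eq_bigr => j _.
by rewrite !linearZ /= -tpure_basis fh.
Qed.

Lemma tens_universal (U : vectType k) (b : V -> W -> U) :
  (forall w, linear (b^~ w)) -> (forall v, linear (b v)) ->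
  exists! f : 'Hom(tens, U), forall v w, f (tpure v w) = b v w.
Proof.
move=> bl br.
have blE w : linfun (b^~ w) =1 b^~ w by apply: linfun_linE; apply: bl.
have brE v : linfun (b v) =1 b v by apply: linfun_linE; apply: br.
pose F (T : tens) := \sum_i \sum_j T i j *: b (vbasis {:V})`_i (vbasis {:W})`_j.
have Flin : linear F.
  move=> c S T; rewrite /F scaler_sumr -big_split; apply: eq_bigr => i _ /=.
  rewrite scaler_sumr -big_split; apply: eq_bigr => j _ /=.
  by rewrite !mxE scalerDl scalerA.
have FE v w : F (tpure v w) = b v w.
  rewrite {2}(coord_vbasis (memvf v)) -blE linear_sum; apply: eq_bigr => i _.
  rewrite linearZ /= blE {2}(coord_vbasis (memvf w)) -brE linear_sum scaler_sumr.
  apply: eq_bigr => j _; rewrite linearZ /= brE scalerA; congr (_ *: _).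
  by rewrite /tpure !mxE big_ord1 !mxE.
exists (linfun F); split=> [v w|f fE]; first by rewrite linfun_linE.
by apply: tens_ext => v w; rewrite linfun_linE // FE fE.
Qed.

Lemma tmapE A B v w : tmap A B (tpure v w) = tpure (A v) (B w).
Proof.
rewrite linfun_linE => [|c S T].
  by rewrite /tpure !(rVof_app _ (vbasisP _)) trmx_mul !mulmxA.
by rewrite mulmxDr mulmxDl -scalemxAr -scalemxAl.
Qed.

Lemma tmap_linearl B : linear (tmap^~ B).
Proof.
move=> c A A'; apply: tens_ext => v w.
by rewrite !(add_lfunE, scale_lfunE, tmapE) tpureDl tpureZl.
Qed.
Lemma tmap_linearr A : linear (tmap A).
Proof.
move=> c B B'; apply: tens_ext => v w.
by rewrite !(add_lfunE, scale_lfunE, tmapE) tpureDr tpureZr.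
Qed.
End Tensor.

Fact tens_sign (k : fieldType) (U : lmodType k) (s p q : k) (A A' B B' C C' : U) :
  s * s = 1 ->
  A - s *: A' + (p * q) *: (C - s *: C') =
  A + (s * p) *: B + q *: (B' + p *: C)
    - s *: (A' + (s * q) *: B' + p *: (B + q *: C')).
Proof.
move=> ss; rewrite !scalerDr !scalerN !scalerA !opprD !addrA mulrA ss mul1r.
rewrite [RHS](ACl (1*5*4*8*(2*7)*(3*6))%AC) /= !subrr !addr0.
by rewrite (mulrC q p) (mulrC (p * q) s) mulrA.
Qed.

Section TensorModule.
Variables (k : fieldType) (g : lieSuperalg k) (M N : smod g).
Implicit Types (a b c d : bool) (x y : g) (v : M) (w : N).

Definition tens_proj a : 'End(tens M N) :=
  tmap (pr M false) (pr N a) + tmap (pr M true) (pr N (~~ a)).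

Lemma tens_proj_pure a b c v w : v \in gr M b -> w \in gr N c ->
  tens_proj a (tpure v w) = if a == b (+) c then tpure v w else 0.
Proof.
move=> vb wc; rewrite add_lfunE !tmapE !(pr_gr_if _ vb) !(pr_gr_if _ wc).
by case: (a) (b) (c) => [] [] [] /=; rewrite ?tpure0l ?tpure0r ?addr0 ?add0r.
Qed.

Lemma tens_gr_ext (U : vectType k) (f h : 'Hom(tens M N, U)) :
  (forall b c v w, v \in gr M b -> w \in gr N c ->
     f (tpure v w) = h (tpure v w)) -> f = h.
Proof.
move=> fh; apply: tens_ext => v w.
rewrite -[v]pr_sum -[w]pr_sum !(tpureDl, tpureDr) !linearD /=.
by rewrite !(fh _ _ _ _ (pr_gr _ _) (pr_gr _ _)).
Qed.

Fact tens_projM a b T :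
  tens_proj a (tens_proj b T) = if a == b then tens_proj b T else 0.
Proof.
pose h : 'End(tens M N) := if a == b then tens_proj b else 0.
have E : (tens_proj a \o tens_proj b)%VF = h.
  apply: tens_gr_ext => c d v w vc wd; rewrite comp_lfunE /h.
  have P := tens_proj_pure _ vc wd.
  by case: ifP => ab; rewrite ?zero_lfunE !P; case: ifP => bcd;
    rewrite ?linear0 // P ?(eqP ab) ?bcd // -(eqP bcd) ab.
by rewrite -comp_lfunE E /h; case: ifP => // _; rewrite zero_lfunE.
Qed.
Fact tens_projS T : tens_proj false T + tens_proj true T = T.
Proof.
rewrite -add_lfunE -[RHS]id_lfunE; congr (fun_of_lfun _ T).
apply: tens_gr_ext => b c v w vb wc.
rewrite add_lfunE !(tens_proj_pure _ vb wc) id_lfunE.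
by case: (b (+) c) => /=; rewrite ?addr0 ?add0r.
Qed.
Definition tens_space := proj_superspace tens_projM tens_projS.

Definition tens_act_fun x : 'End(tens_space) :=
  tmap (act M x) \1 + tmap \1 (act N (pr g false x))
    + tmap (par M) (act N (pr g true x)).
Definition tens_act : 'Hom(g, 'End(tens_space)) := linfun tens_act_fun.

Lemma tens_act_funE x : tens_act x = tens_act_fun x.
Proof.
rewrite linfun_linE // /tens_act_fun; move: (par M) => p c y z.
rewrite !linearP !tmap_linearr tmap_linearl !scalerDr.
by rewrite (addrACA _ (tmap (act M z) _)) (addrACA (_ + _) (_ + tmap _ _)).
Qed.

(* x (v (x) w) = x v (x) w + (-1)^(|x||v|) v (x) x w *)
Lemma tens_actE a b x v w : x \in gr g a -> v \in gr M b ->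
  tens_act x (tpure v w) =
    tpure (act M x v) w + (-1) ^+ (a && b) *: tpure v (act N x w).
Proof.
move=> xa vb; rewrite tens_act_funE 2!add_lfunE !tmapE !id_lfunE.
rewrite (par_gr vb) !(pr_gr_if _ xa) -addrA; congr (_ + _).
case: (a) => /=; rewrite linear0 zero_lfunE tpure0r ?add0r ?addr0.
  by rewrite tpureZl.
by rewrite expr0 scale1r.
Qed.

Lemma mem_tens_pure b c v w : v \in gr M b -> w \in gr N c ->
  tpure v w \in gr tens_space (b (+) c).
Proof.
by move=> vb wc; rewrite (proj_mem tens_projM) (tens_proj_pure _ vb wc) eqxx.
Qed.

Fact tens_act_gr a b x T : x \in gr g a -> T \in gr tens_space b ->
  tens_act x T \in gr tens_space (a (+) b).
Proof.
move=> xa; rewrite !(proj_mem tens_projM) => /eqP <-; apply/eqP.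
rewrite -2!comp_lfunE -[RHS]comp_lfunE; congr (fun_of_lfun _ T).
apply: tens_gr_ext => c d v w vc wd.
rewrite 3!comp_lfunE (tens_proj_pure _ vc wd).
case: eqP => [->|_]; last by rewrite !linear0.
apply/eqP; rewrite -(proj_mem tens_projM) (tens_actE _ xa vc).
apply: memvD; first by rewrite addbA; apply: mem_tens_pure => //; apply: act_gr.
by apply: memvZ; rewrite addbCA; apply: mem_tens_pure => //; apply: act_gr.
Qed.

Fact tens_act_br a b x y T : x \in gr g a -> y \in gr g b ->
  tens_act (br g x y) T = tens_act x (tens_act y T)
    - (-1) ^+ (a && b) *: tens_act y (tens_act x T).
Proof.
move=> xa yb; rewrite -(comp_lfunE (tens_act x)) -(comp_lfunE (tens_act y)) -scale_lfunE -opp_lfunE -add_lfunE.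
congr (fun_of_lfun _ T); apply: tens_gr_ext => c d v w vc wd.
rewrite add_lfunE opp_lfunE scale_lfunE.
rewrite (comp_lfunE (tens_act x)) (comp_lfunE (tens_act y)).
have E p q (z t : g) u (r : N) : z \in gr g p -> t \in gr g q -> u \in gr M c ->
    tens_act z (tens_act t (tpure u r)) =
      tpure (act M z (act M t u)) r
      + (-1) ^+ (p && (q (+) c)) *: tpure (act M t u) (act N z r)
      + (-1) ^+ (q && c) *: (tpure (act M z u) (act N t r)
          + (-1) ^+ (p && c) *: tpure u (act N z (act N t r))).
  move=> zp tq uc; rewrite (tens_actE _ tq uc) linearD linearZ /=.
  by rewrite (tens_actE _ zp (act_gr tq uc)) (tens_actE _ zp uc).
rewrite (E _ _ _ _ _ w xa yb vc) (E _ _ _ _ _ w yb xa vc).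
rewrite (tens_actE _ (br_gr xa yb) vc) !(act_br _ xa yb).
have Eac : (-1 : k) ^+ (a && (b (+) c)) = (-1) ^+ (a && b) * (-1) ^+ (a && c).
  by rewrite -signr_addb; congr (_ ^+ _); case: (a) (b) (c) => [] [] [].
have Ebc : (-1 : k) ^+ (b && (a (+) c)) = (-1) ^+ (a && b) * (-1) ^+ (b && c).
  by rewrite -signr_addb; congr (_ ^+ _); case: (a) (b) (c) => [] [] [].
have Eabc : (-1 : k) ^+ ((a (+) b) && c) = (-1) ^+ (a && c) * (-1) ^+ (b && c).
  by rewrite -signr_addb; congr (_ ^+ _); case: (a) (b) (c) => [] [] [].
rewrite Eac Ebc Eabc -!scaleNr !(tpureDl, tpureDr, tpureZl, tpureZr) !scaleNr.
by apply: tens_sign; rewrite -signr_addb addbb.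
Qed.
Definition tensor : smod g := Smod tens_act_gr tens_act_br.
End TensorModule.

Definition endotrivial (k : fieldType) (g : lieSuperalg k) (M : smod g) :=
  in_F M /\ exists P : smod g,
    projective P /\ sisom (tensor M (sdual M)) (dsum (kev g) P).

(* Reductive groups are affine, so they are taken as Zariski closed subgroups
   of some GL_N, given by their sets of k-points; in characteristic 0 algebraic
   groups are reduced and nothing is lost.  A polynomial in N * N variables is
   a polynomial function on 'M_N through [mxvec]. *)
Section AlgebraicGroups.
Variables (k : fieldType) (N : nat).
Implicit Types (A B X : 'M[k]_N) (G U Z : 'M[k]_N -> Prop) (p : {mpoly k[N * N]}).

Definition mxeval p A : k := p.@[fun i => mxvec A 0 i].

(* the differential of p at the identity matrix, in the direction X *)
Definition mxdiff p X : k :=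
  \sum_i (p^`M(i)).@[fun j => mxvec (1%:M : 'M[k]_N) 0 j] * mxvec X 0 i.

(* closed in GL_N *)
Definition zclosed Z := exists S : {mpoly k[N * N]} -> Prop,
  forall A, A \in unitmx -> (Z A <-> forall p, S p -> mxeval p A = 0).

Definition alg_group G :=
  [/\ forall A, G A -> A \in unitmx, zclosed G, G 1%:M,
      forall A B, G A -> G B -> G (A *m B) & forall A, G A -> G (invmx A)].

Definition zconnected G := forall Z1 Z2, zclosed Z1 -> zclosed Z2 ->
  (forall A, G A -> Z1 A \/ Z2 A) -> (forall A, G A -> ~ (Z1 A /\ Z2 A)) ->
  (forall A, G A -> Z1 A) \/ (forall A, G A -> Z2 A).

Definition unipotent U := forall A, U A -> exists m : nat, (A - 1%:M) ^+ m = 0.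

Definition reductive G := alg_group G /\
  forall U, alg_group U -> (forall A, U A -> G A) ->
    (forall A B, G A -> U B -> U (A *m B *m invmx A)) ->
    zconnected U -> unipotent U -> forall A, U A -> A = 1%:M.

(* the tangent space at the identity *)
Definition lie_of G X :=
  forall p, (forall A, G A -> mxeval p A = 0) -> mxdiff p X = 0.

(* The regular functions on a closed subgroup of GL_N are the restrictions of
   the p / det ^ m. *)
Definition regeval (m : nat) p A : k := mxeval p A / \det A ^+ m.

(* The differential at 1 of p / det ^ m, the differential of det at 1 being
   the trace. *)
Definition regdiff (m : nat) p X : k :=
  mxdiff p X - m%:R * \tr X * mxeval p 1%:M.

End AlgebraicGroups.

Section Classical.
Variables (k : fieldType) (g : lieSuperalg k) (N : nat) (G : 'M[k]_N -> Prop).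

(* theta restricts to an isomorphism of Lie algebras from the even part of g
   onto Lie(G). *)
Definition lie_iso (theta : 'Hom(g, 'M[k]_N)) :=
  [/\ (lker theta :&: gr g false)%VS = 0%VS,
      forall X, lie_of G X <-> X \in (theta @: gr g false)%VS &
      forall x y, x \in gr g false -> y \in gr g false ->
        theta (br g x y) = theta x *m theta y - theta y *m theta x].

Definition odd_action (rho : 'M[k]_N -> 'End(g)) :=
  [/\ forall A v, G A -> v \in gr g true -> rho A v \in gr g true,
      forall v, v \in gr g true -> rho 1%:M v = v &
      forall A B v, G A -> G B -> v \in gr g true ->
        rho (A *m B) v = rho A (rho B v)].

(* Every matrix coefficient A |-> f (rho A v) of the action on the odd part is
   a regular function on G, and its differential at 1 is x |-> f [x, v]. *)
Definition differentiates_to_ad (theta : 'Hom(g, 'M[k]_N))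
    (rho : 'M[k]_N -> 'End(g)) :=
  forall (v : g) (f : 'Hom(g, k^o)), v \in gr g true ->
  exists (m : nat) (p : {mpoly k[N * N]}),
    (forall A, G A -> f (rho A v) = regeval m p A) /\
    (forall x, x \in gr g false -> f (br g x v) = regdiff m p (theta x)).

End Classical.

Definition classical (k : fieldType) (g : lieSuperalg k) :=
  exists (N : nat) (G : 'M[k]_N -> Prop), [/\ reductive G, zconnected G &
    exists (theta : 'Hom(g, 'M[k]_N)) (rho : 'M[k]_N -> 'End(g)),
      [/\ lie_iso G theta, odd_action G rho & differentiates_to_ad G theta rho]].

(* Main.v *)
From HB Require Import structures.
Require Import Defs.
From mathcomp Require Import all_boot all_order all_algebra.
From Stdlib Require Import Classical.

(** The argument is geometric: endotrivial modules are rigid, a rigid module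
    has an open orbit in the variety of module structures extending a given
    action of the even part g0, and such a variety has room for finitely many
    open orbits only.

    Rigidity.  Let M be endotrivial, with M (x) M^* = k_ev + P.  A first order
    deformation of the action of g on M that leaves the action of g0 unchanged
    is an even g0-equivariant 1-cocycle phi : g1 -> End(M).  Contracted with
    the evaluation of M^* on M it becomes a 1-cocycle with values in the dual
    of M (x) M^*, that is, an extension of M (x) M^* by k_ev.  This extension
    splits over P because P is projective, and over k_ev because an even map
    from g1 to k_ev is zero.  The splitting is a functional on M (x) M^*, hence
    an endomorphism of M, and its coboundary is phi ([endotrivial_rigid]).

    Restrictions to g0.  A module M of F is semisimple over g0, so as a
    g0-module it is the sum of its composition factors, which are simple
    objects of F of dimension at most dim M.  If there are finitely many of
    these, there are finitely many possible restrictions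
    ([finite_restrictions]).

    Open orbits.  Fix a g0-module T.  For two module structures a0 and a on T
    that extend its g0-action, let C^0(a0, a) -> C^1(a0, a) -> C^2(a0, a) be the
    start of the relative cochain complex that computes the extensions of
    (T, a) by (T, a0); the spaces do not depend on (a0, a) and the
    differentials are affine in it.  If a0 is rigid, the complex is exact at
    C^1 for a = a0, hence for every a outside the zero set of a polynomial, and
    there the 0-cocycle id, an isomorphism from (T, a0) to itself, extends to a
    family of 0-cocycles depending rationally on a, which are isomorphisms
    outside the zero set of one more polynomial.  Thus there is a polynomial
    q(a0, a) with q(a0, a0) <> 0 such that q(a0, a) <> 0 forces (T, a) to be
    isomorphic to (T, a0) ([open_orbits]).

    Finiteness.  The function q is a finite sum of terms c(a0) b(a).  If the
    vectors c(a_1), .., c(a_t) span all the vectors c(a0), then no rigid a is a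
    zero of all the q(a_i, -), since it is not a zero of q(a, -); hence every
    rigid a is isomorphic to one of the a_i ([separable_cover]).  This takes
    the place of the Hilbert basis theorem. *)

Set Implicit Arguments.
Unset Strict Implicit.
Unset Printing Implicit Defensive.

Import GRing.Theory passmx.
Local Open Scope ring_scope.

(** * Functions of two points of finite separable rank *)

(** Any family of vectors, over an arbitrary index type, has a finite subfamily
    with the same span; keep adding vectors until the dimension stops growing. *)
Lemma finite_spanning (k : fieldType) (V : vectType k) (E : Type) (c : E -> V) :
  exists t (L : t.-tuple E), forall x, c x \in <<map_tuple c L>>%VS.
Proof.
suff H d (s : seq E) : (\dim {:V} <= \dim <<map c s>>%VS + d)%N ->
    exists s' : seq E, forall x, c x \in <<map c s'>>%VS.
  have [|s Hs] := H (\dim {:V}) [::]; first exact: leq_addl.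
  by exists (size s), (in_tuple s).
elim: d s => [|d IH] s; rewrite ?addn0 => ds.
  exists s => x; have /eqP-> : (<<map c s>> == {:V})%VS by rewrite eqEdim subvf.
  exact: memvf.
have [|/not_all_ex_not[x xs]] := classic (forall x, c x \in <<map c s>>%VS).
  by exists s.
apply: (IH (x :: s)); apply: leq_trans ds _; rewrite addnS -addSn leq_add2r.
rewrite ltnNge; apply/negP => le; apply: xs.
have /eqP-> : (<<map c s>> == <<map c (x :: s)>>)%VS.
  by rewrite eqEdim le andbT /= span_cons addvSr.
by rewrite /= span_cons; apply: subvP (addvSl _ _) _ _; apply: memv_line.
Qed.

Section Separable.
Variables (k : fieldType) (E : Type).
Implicit Types F : E -> E -> k.

(** Membership of F in the tensor product of the space of functions of x with
    that of functions of y.  No regularity of the factors is asked for, so any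
    expression polynomial in quantities that depend on one point each
    qualifies, whatever the other operations (such as generalized inverses)
    that went into these quantities. *)
Definition separable F := exists (I : finType) (c b : E -> I -> k),
  forall x y, F x y = \sum_i c x i * b y i.

Lemma separable_eq F F' : (forall x y, F x y = F' x y) ->
  separable F' -> separable F.
Proof. by move=> FF [I [c [b H]]]; exists I, c, b => x y; rewrite FF. Qed.

Lemma separable_l (f : E -> k) : separable (fun x _ => f x).
Proof.
exists unit, (fun x _ => f x), (fun _ _ => 1) => x y.
by rewrite (bigD1 tt) //= big1 ?mulr1 ?addr0 // => -[].
Qed.

Lemma separable_r (f : E -> k) : separable (fun _ y => f y).
Proof.
exists unit, (fun _ _ => 1), (fun y _ => f y) => x y.
by rewrite (bigD1 tt) //= big1 ?mul1r ?addr0 // => -[].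
Qed.

Lemma separableD F F' : separable F -> separable F' ->
  separable (fun x y => F x y + F' x y).
Proof.
move=> [I [c [b H]]] [I' [c' [b' H']]].
pose glue (f : E -> I -> k) (f' : E -> I' -> k) x (i : I + I') :=
  match i with inl i => f x i | inr i => f' x i end.
exists (I + I')%type, (glue c c'), (glue b b') => x y.
by rewrite big_sumType /= H H'.
Qed.

Lemma separableM F F' : separable F -> separable F' ->
  separable (fun x y => F x y * F' x y).
Proof.
move=> [I [c [b H]]] [I' [c' [b' H']]].
exists (I * I')%type, (fun x i => c x i.1 * c' x i.2),
  (fun y i => b y i.1 * b' y i.2) => x y.
rewrite H H' big_distrlr /= pair_big /=.
by apply: eq_bigr => -[i j] _ /=; rewrite mulrACA.
Qed.

Lemma separable_sum J (r : seq J) (F : J -> E -> E -> k) :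
  (forall j, separable (F j)) -> separable (fun x y => \sum_(j <- r) F j x y).
Proof.
move=> H; elim: r => [|j r IH].
  by apply: separable_eq (separable_l (fun => 0)) => x y; rewrite big_nil.
by apply: separable_eq (separableD (H j) IH) => x y; rewrite big_cons.
Qed.

Lemma separable_prod J (r : seq J) (F : J -> E -> E -> k) :
  (forall j, separable (F j)) -> separable (fun x y => \prod_(j <- r) F j x y).
Proof.
move=> H; elim: r => [|j r IH].
  by apply: separable_eq (separable_l (fun => 1)) => x y; rewrite big_nil.
by apply: separable_eq (separableM (H j) IH) => x y; rewrite big_cons.
Qed.

Definition separable_mx m n (A : E -> E -> 'M[k]_(m, n)) :=
  forall i j, separable (fun x y => A x y i j).

Lemma separable_mxl m n (A : E -> 'M[k]_(m, n)) : separable_mx (fun x _ => A x).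
Proof. by move=> i j; apply: (separable_l (fun x => A x i j)). Qed.

Lemma separable_mxr m n (A : E -> 'M[k]_(m, n)) : separable_mx (fun _ y => A y).
Proof. by move=> i j; apply: (separable_r (fun y => A y i j)). Qed.

Lemma separable_addmx m n (A B : E -> E -> 'M[k]_(m, n)) :
  separable_mx A -> separable_mx B -> separable_mx (fun x y => A x y + B x y).
Proof.
by move=> HA HB i j; apply: separable_eq (separableD (HA i j) (HB i j)) => x y;
  rewrite mxE.
Qed.

Lemma separable_mulmx m n p (A : E -> E -> 'M[k]_(m, n)) (B : E -> E -> 'M[k]_(n, p)) :
  separable_mx A -> separable_mx B -> separable_mx (fun x y => A x y *m B x y).
Proof.
move=> HA HB i j.
apply: separable_eq (separable_sum _ (fun l => separableM (HA i l) (HB l j))) => x y.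
by rewrite mxE.
Qed.

Lemma separable_det n (A : E -> E -> 'M[k]_n) :
  separable_mx A -> separable (fun x y => \det (A x y)).
Proof.
move=> HA; apply: separable_sum => s.
by apply: separableM (separable_l _) (separable_prod _ _) => i; apply: HA.
Qed.

Lemma separable_adj n (A : E -> E -> 'M[k]_n) :
  separable_mx A -> separable_mx (fun x y => \adj (A x y)).
Proof.
move=> HA i j.
apply: (@separable_eq _ (fun x y => (-1) ^+ (j + i) *
  \det (row' j (col' i (A x y))))) => [x y|].
  by rewrite mxE.
apply: separableM (separable_l _) (separable_det _) => p q.
by apply: separable_eq (HA (lift j p) (lift i q)) => x y; rewrite !mxE.
Qed.

Lemma separable_linear a m n (f : {linear 'rV[k]_a -> 'M[k]_(m, n)})
    (v : E -> E -> 'rV[k]_a) :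
  separable_mx v -> separable_mx (fun x y => f (v x y)).
Proof.
move=> Hv i j.
have H l := separableM (Hv 0 l) (separable_l (fun=> f (delta_mx 0 l) i j)).
apply: separable_eq (separable_sum _ H) => x y.
rewrite [v x y in LHS]row_sum_delta linear_sum summxE.
by apply: eq_bigr => l _; rewrite linearZ mxE.
Qed.

(** The functions [F x] lie in the finite dimensional space spanned by the
    second factors, so finitely many of them span all; a common zero [y] of
    these would be a zero of [F y]. *)
Lemma separable_cover F : separable F -> (forall x, F x x != 0) ->
  exists t (L : 'I_t -> E), forall y, exists i, F (L i) y != 0.
Proof.
move=> [I [c [b FE]]] Fxx.
have [t [L LE]] := finite_spanning (fun x : E => [ffun i => c x i] : {ffun I -> k^o}).
exists t, (tnth L) => y; apply: NNPP => H; case/eqP: (Fxx y).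
have {}H i : F (tnth L i) y = 0.
  by apply/eqP/negPn/negP => N; apply: H; exists i.
have cE i : c y i = \sum_j coord (map_tuple (fun x => [ffun i => c x i] : {ffun I -> k^o}) L) j
    [ffun i => c y i] * c (tnth L j) i.
  have /(congr1 (fun f : {ffun I -> k^o} => f i)) := coord_span (LE y).
  rewrite ffunE sum_ffunE => ->; apply: eq_bigr => j _.
  by rewrite ffunE -tnth_nth tnth_map ffunE.
rewrite FE (eq_bigr _ (fun i _ => congr1 ( *%R^~ (b y i)) (cE i))).
under eq_bigr do rewrite mulr_suml.
rewrite exchange_big big1 //= => j _.
under eq_bigr do rewrite -mulrA.
by rewrite -mulr_sumr -FE H mulr0.
Qed.

End Separable.

(** * Openness of exactness and of orbits *)

(** The partial inverse X of A provided by [pinvmx] satisfies A X A = A; the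
    relation X A X = X is obtained by sandwiching A between two copies of it. *)
Definition reflexive_inv (k : fieldType) a b (A : 'M[k]_(a, b)) : 'M_(b, a) :=
  pinvmx A *m A *m pinvmx A.

Lemma mul_reflexive_inv (k : fieldType) a b (A : 'M[k]_(a, b)) (X := reflexive_inv A) :
  A *m X *m A = A /\ X *m A *m X = X.
Proof.
rewrite /X /reflexive_inv; have := mulmxKpV (submx_refl A).
move: (pinvmx A) => P AK.
have PK : P *m A *m P *m A = P *m A by rewrite -[in RHS]AK !mulmxA.
by rewrite !mulmxA !AK !PK.
Qed.

(** Exactness of a complex of vector spaces in the middle degree amounts to a
    homotopy to zero there.  The homotopy is given by an explicit formula in
    order to be a function of A and B, without a choice. *)
Lemma contracting_homotopy (k : fieldType) a b c (A : 'M[k]_(a, b)) (B : 'M[k]_(b, c))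
    (X := reflexive_inv A) :
  (forall w : 'rV_b, w *m B = 0 -> exists v, w = v *m A) ->
  X *m A + B *m (pinvmx B *m (1%:M - X *m A)) = 1%:M.
Proof.
move=> exact_b; have [AXA _] := mul_reflexive_inv A.
rewrite -/X in AXA; move: (X) AXA => {}X AXA.
have kerE (w : 'rV_b) : w *m B = 0 -> w *m (1%:M - X *m A) = 0.
  by move=> /exact_b[v ->]; rewrite mulmxBr mulmx1 -(mulmxA v) (mulmxA A) AXA subrr.
have /eqP : (1%:M - B *m pinvmx B) *m (1%:M - X *m A) = 0.
  apply/row_matrixP => i; rewrite row_mul row0 kerE //.
  by rewrite -row_mul mulmxBl mul1mx mulmxKpV // subrr row0.
rewrite mulmxBl mul1mx subr_eq0 -mulmxA => /eqP <-.
by rewrite addrC subrK.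
Qed.

(** Let X, Y be the contracting homotopy of the complex A x x, B x x.  As long
    as H = X (A x y) + (B x y) Y is invertible, the image of A x y meets the
    kernel of X trivially.  The vector psi solves psi J = det(J) e; multiplying
    by (A x x) X shows that psi (A x y) X = 0, whence psi (A x y) = 0.  At
    y = x both J and H are the identity and psi = e, so that
    det(J) det(H) det(nu psi) is a function to which [separable_cover]
    applies.  Vectors are rows, so maps compose from left to right. *)
Lemma open_orbits (k : fieldType) (E : Type) a b c N
  (al be : E -> 'M[k]_(a, b)) (ga de : E -> 'M[k]_(b, c))
  (e : 'rV[k]_a) (nu : {linear 'rV[k]_a -> 'M[k]_N})
  (A := fun x y => be x + al y) (B := fun x y => de x + ga y) :
  (forall x y, A x y *m B x y = 0) ->
  (forall x (w : 'rV_b), w *m B x x = 0 -> exists v, w = v *m A x x) ->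
  (forall x, e *m A x x = 0) -> \det (nu e) != 0 ->
  exists t (L : 'I_t -> E), forall y, exists i (v : 'rV_a),
    v *m A (L i) y = 0 /\ \det (nu v) != 0.
Proof.
move=> AB0 exact_b eA nue.
pose X x := reflexive_inv (A x x).
pose Y x := pinvmx (B x x) *m (1%:M - X x *m A x x).
pose J x y := 1%:M + (A x y - A x x) *m X x.
pose H x y := X x *m A x y + B x y *m Y x.
pose psi x y := e *m \adj (J x y).
have sepA : separable_mx A by exact: separable_addmx (separable_mxl _) (separable_mxr _).
have sepB : separable_mx B by exact: separable_addmx (separable_mxl _) (separable_mxr _).
have sepJ : separable_mx J.
  apply: separable_addmx (separable_mxl _) (separable_mulmx _ (separable_mxl _)).
  exact: separable_addmx sepA (separable_mxl (fun x => - A x x)).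
have sepH : separable_mx H.
  exact: separable_addmx (separable_mulmx (separable_mxl _) sepA)
    (separable_mulmx sepB (separable_mxl _)).
have sep_psi : separable_mx psi.
  exact: separable_mulmx (separable_mxl _) (separable_adj sepJ).
have [||t [L LP]] := @separable_cover k E
    (fun x y => \det (J x y) * \det (H x y) * \det (nu (psi x y))).
- apply: separableM (separableM (separable_det sepJ) (separable_det sepH)) _.
  exact: separable_det (separable_linear _ sep_psi).
- move=> x; have J1 : J x x = 1%:M by rewrite /J subrr mul0mx addr0.
  have H1 : H x x = 1%:M by exact: contracting_homotopy (exact_b x).
  have adj1 : \adj (1%:M : 'M[k]_a) = 1%:M.
    by have := mul_mx_adj (1%:M : 'M[k]_a); rewrite mul1mx det1.
  by rewrite /psi J1 H1 adj1 mulmx1 !det1 !mul1r.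
exists t, L => y; have [i p] := LP y; exists i, (psi (L i) y); move: (L i) p => x.
rewrite !mulf_eq0 !negb_or => /andP[/andP[J0 H0] nu0]; split=> //.
have Hu : H x y \in unitmx by rewrite unitmxE unitfE.
have [AXA XAX] := mul_reflexive_inv (A x x); rewrite -/(X x) in AXA XAX.
have psiJ : psi x y *m J x y = \det (J x y) *: e.
  by rewrite -mulmxA mul_adj_mx mul_mx_scalar.
set w := psi x y *m A x y.
(* multiply psi J = det(J) e by (A x x) X and use e (A x x) = 0 *)
have wX : w *m X x = 0.
  have WX v : v *m X x *m A x x *m X x = v *m X x.
    by rewrite -!(mulmxA v) XAX.
  have := congr1 (fun v => v *m A x x *m X x) psiJ.
  rewrite -!scalemxAl eA mul0mx scaler0 /J mulmxDr mulmx1 mulmxA mulmxBr -/w.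
  by rewrite mulmxBl !mulmxDl !mulNmx !WX addrC subrK.
apply: (can_inj (mulmxK Hu)); rewrite mul0mx /H mulmxDr (mulmxA w (X x)) wX.
by rewrite mul0mx add0r (mulmxA w) -(mulmxA (psi x y)) AB0 mulmx0 mul0mx.
Qed.

(** * Restriction to the even part *)

Lemma linear_hom (k : fieldType) (U V : vectType k) (f : U -> V) :
  linear f -> exists F : 'Hom(U, V), forall u, F u = f u.
Proof. by move=> fl; exists (linfun f); apply: linfun_linE. Qed.

Section Projections.
Variable k : fieldType.

Lemma pr_proj (V : vectType k) (e : bool -> 'End(V))
    (eM : forall a b v, e a (e b v) = if a == b then e b v else 0)
    (eS : forall v, e false v + e true v = v) a v :
  pr (proj_superspace eM eS) a v = e a v.
Proof.
pose S := proj_superspace eM eS.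
have egr b u : e b u \in gr S b by apply/memv_img/memvf.
rewrite -[v in LHS]eS linearD /= !(@pr_gr_if _ S _ _ _ (egr _ _)).
by case: a; rewrite ?add0r ?addr0.
Qed.

Lemma gr_pr (V : superspace k) a (v : V) : (v \in gr V a) = (pr V a v == v).
Proof. by apply/idP/eqP => [/pr_id //|<-]; apply: pr_gr. Qed.

Definition evenf (V W : superspace k) (f : V -> W) :=
  forall a v, v \in gr V a -> f v \in gr W a.

Lemma even_pr (V W : superspace k) (f : {linear V -> W}) a v :
  evenf f -> f (pr V a v) = pr W a (f v).
Proof.
move=> fe; rewrite -[v in RHS]pr_sum !linearD /= !(pr_gr_if a (fe _ _ (pr_gr _ _))).
by case: a; rewrite ?add0r ?addr0.
Qed.

End Projections.

Section Restriction.
Variables (k : fieldType) (g : lieSuperalg k).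
Implicit Types M N P : smod g.

Lemma act_dsum M N x u v : act (dsum M N) x (u, v) = (act M x u, act N x v).
Proof. exact: dsum_actE. Qed.

Definition is_shom0 M N (f : M -> N) :=
  evenf f /\ forall x m, x \in gr g false -> f (act M x m) = act N x (f m).

Definition iso0 M N := exists (f : 'Hom(M, N)) (h : 'Hom(N, M)),
  [/\ is_shom0 f, is_shom0 h, cancel f h & cancel h f].

Lemma sisom_iso0 M N : sisom M N -> iso0 M N.
Proof.
move=> [f [h [[fe fa] [he ha] hf fh]]]; exists f, h; split.
- by split=> // x m _; apply: fa.
- by split=> // x m _; apply: ha.
- by move=> m; rewrite -comp_lfunE hf id_lfunE.
- by move=> m; rewrite -comp_lfunE fh id_lfunE.
Qed.

Lemma iso0_trans N M P : iso0 M N -> iso0 N P -> iso0 M P.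
Proof.
move=> [f [h [[fe fa] [he ha] hf fh]]] [f' [h' [[fe' fa'] [he' ha'] hf' fh']]].
exists (f' \o f)%VF, (h \o h')%VF; split.
- by split=> [a m /fe/fe'|x m xa]; rewrite !comp_lfunE // fa // fa'.
- by split=> [a m /he'/he|x m xa]; rewrite !comp_lfunE // ha' // ha.
- by move=> m; rewrite !comp_lfunE hf' hf.
- by move=> m; rewrite !comp_lfunE fh fh'.
Qed.

Lemma iso0_dsum M M' N N' : iso0 M M' -> iso0 N N' -> iso0 (dsum M N) (dsum M' N').
Proof.
have D (A A' B B' : smod g) (f : 'Hom(A, A')) (h : 'Hom(B, B')) :
    is_shom0 f -> is_shom0 h ->
    exists2 F : 'Hom(dsum A B, dsum A' B'), is_shom0 F &
      forall u v, F (u, v) = (f u, h v).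
  move=> [fe fa] [he ha].
  have L : linear (fun u : dsum A B => (f u.1, h u.2) : dsum A' B').
    by move=> c [p q] [r s] /=; rewrite !linearP.
  have [F FE] := linear_hom L; exists F => [|u v]; last exact: FE.
  split=> [a [u v]|x [u v] xa]; rewrite !FE.
    by rewrite !mem_dsum => /andP[/fe -> /he ->].
  by rewrite !act_dsum /= fa // ha.
move=> [f [f' [F F' ff' f'f]]] [h [h' [H H' hh' h'h]]].
have [P P0 PE] := D _ _ _ _ _ _ F H; have [Q Q0 QE] := D _ _ _ _ _ _ F' H'.
by exists P, Q; split=> // -[u v]; rewrite !(PE, QE) ?ff' ?hh' ?f'f ?h'h.
Qed.

Lemma iso0_dim0 M N : \dim {:M} = 0%N -> \dim {:N} = 0%N -> iso0 M N.
Proof.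
move=> /eqP; rewrite dimv_eq0 => /eqP M0 /eqP; rewrite dimv_eq0 => /eqP N0.
have ZM (m : M) : m = 0 by apply/eqP; rewrite -memv0 -M0 memvf.
have ZN (m : N) : m = 0 by apply/eqP; rewrite -memv0 -N0 memvf.
exists 0, 0; split=> [||m|m]; rewrite ?(ZM m) ?(ZN m) ?zero_lfunE //.
  by split=> [a m _|x m _]; rewrite !zero_lfunE ?mem0v ?linear0.
by split=> [a m _|x m _]; rewrite !zero_lfunE ?mem0v ?linear0.
Qed.

Lemma is_submod0_img M N (f : 'Hom(M, N)) (U : {vspace M}) :
  is_shom0 f -> is_submod0 U -> is_submod0 (f @: U)%VS.
Proof.
move=> [fe fa] [Ug Ua]; split=> [a _ /memv_imgP[u uU ->]|x _ xa /memv_imgP[u uU ->]].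
  by rewrite -(even_pr _ _ fe) memv_img ?Ug.
by rewrite -fa // memv_img ?Ua.
Qed.

Lemma is_submod0_preim M N (f : 'Hom(M, N)) (U : {vspace N}) :
  is_shom0 f -> is_submod0 U -> is_submod0 (f @^-1: U)%VS.
Proof.
move=> [fe fa] [Ug Ua]; split=> [a u|x u xa]; rewrite -!memv_preim => uU.
  by rewrite (even_pr _ _ fe) Ug.
by rewrite fa // Ua.
Qed.

Lemma is_submod0_cap M (U V : {vspace M}) :
  is_submod0 U -> is_submod0 V -> is_submod0 (U :&: V)%VS.
Proof.
move=> [Ug Ua] [Vg Va]; split=> [a u|x u xa]; rewrite !memv_cap => /andP[uU uV].
  by rewrite Ug ?Vg.
by rewrite Ua ?Va.
Qed.

Lemma compl_eq (V : vectType k) (U W : {vspace V}) :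
  (forall v, exists2 u, u \in U & v - u \in W) ->
  (forall v, v \in U -> v \in W -> v = 0) ->
  (U + W = fullv)%VS /\ (U :&: W = 0)%VS.
Proof.
move=> H H0; split.
  apply/vspaceP => v; rewrite memvf; have [u uU vW] := H v.
  by rewrite -[v](subrKC u) memv_add.
apply/eqP; rewrite -subv0; apply/subvP => v; rewrite memv_cap memv0.
by move=> /andP[vU vW]; rewrite (H0 v).
Qed.

Lemma compl_dec (V : vectType k) (U W : {vspace V}) : (U + W = fullv)%VS ->
  forall v, exists2 u, u \in U & v - u \in W.
Proof.
move=> UW v; have /memv_addP[u uU [w wW ->]] : v \in (U + W)%VS by rewrite UW memvf.
by exists u; rewrite // addrC addKr.
Qed.

Lemma cap_eq0 (V : vectType k) (U W : {vspace V}) v : (U :&: W = 0)%VS ->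
  v \in U -> v \in W -> v = 0.
Proof. by move=> UW vU vW; apply/eqP; rewrite -memv0 -UW memv_cap vU. Qed.

(** A complement in M of the image of a submodule of N pulls back to a
    complement in N. *)
Lemma in_F_inj M N (i : 'Hom(N, M)) :
  is_shom0 i -> injective i -> in_F M -> in_F N.
Proof.
move=> i0 ii FM U U0; have [Y [Y0 UY UY0]] := FM _ (is_submod0_img i0 U0).
exists (i @^-1: Y)%VS; have [||A B] := @compl_eq _ U (i @^-1: Y)%VS.
- move=> w; have [_ /memv_imgP[u uU ->] wY] := compl_dec UY (i w).
  by exists u => //; rewrite -memv_preim linearB.
- move=> v vU; rewrite -memv_preim => vY; apply: ii; rewrite linear0.
  by apply: cap_eq0 UY0 _ vY; apply: memv_img.
by split=> //; apply: is_submod0_preim.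
Qed.

(** For a submodule U of M + N, a complement of U :&: M in M and one of the
    projection of U to N in N have for sum a complement of U. *)
Lemma in_F_dsum M N : in_F M -> in_F N -> in_F (dsum M N).
Proof.
move=> FM FN U U0.
have [i iE] : exists i : 'Hom(M, dsum M N), forall m, i m = (m, 0).
  by apply: linear_hom => c u v; apply: injective_projections; rewrite /= ?scaler0 ?addr0.
have [p pE] : exists p : 'Hom(dsum M N, N), forall m, p m = m.2.
  exact: linear_hom.
have [q qE] : exists q : 'Hom(dsum M N, M), forall m, q m = m.1.
  exact: linear_hom.
have i0 : is_shom0 i.
  by split=> [a m mM|x m xa]; rewrite !iE ?mem_dsum ?act_dsum ?linear0 // mM mem0v.
have p0 : is_shom0 p.
  by split=> [a [u v]|x [u v] xa]; rewrite !pE ?mem_dsum ?act_dsum //= => /andP[].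
have q0 : is_shom0 q.
  by split=> [a [u v]|x [u v] xa]; rewrite !qE ?mem_dsum ?act_dsum //= => /andP[].
have [M' [M'0 UM UM0]] := FM _ (is_submod0_preim i0 U0).
have [N' [N'0 UN UN0]] := FN _ (is_submod0_img p0 U0).
exists (q @^-1: M' :&: p @^-1: N')%VS.
have W0 : is_submod0 (q @^-1: M' :&: p @^-1: N')%VS.
  by apply: is_submod0_cap; apply: is_submod0_preim.
have WE m n : (((m, n) : dsum M N) \in (q @^-1: M' :&: p @^-1: N')%VS)
    = (m \in M') && (n \in N').
  by rewrite memv_cap -!memv_preim qE pE.
have [||A B] := @compl_eq _ U (q @^-1: M' :&: p @^-1: N')%VS; last by split.
- move=> [m n]; have [_ /memv_imgP[[u1 u2] uU ->]] := compl_dec UN n.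
  rewrite pE /= => nN'; have [u] := compl_dec UM (m - u1); rewrite -memv_preim iE.
  move=> uU' mM'; exists ((u1, u2) + (u, 0) : dsum M N); first exact: memvD.
  have -> : ((m, n) : dsum M N) - ((u1, u2) + (u, 0)) = (m - u1 - u, n - u2).
    by apply: injective_projections; rewrite /= ?addr0 // opprD addrA.
  by rewrite WE mM'.
move=> [m n] mU; rewrite WE => /andP[mM' nN'].
have n0 : n = 0.
  by apply: cap_eq0 UN0 _ nN'; apply/memv_imgP; exists (m, n); rewrite ?pE.
rewrite n0 in mU *; congr (_, _); apply: cap_eq0 UM0 _ mM'.
by rewrite -memv_preim iE.
Qed.

Lemma in_F_kev : in_F (kev g).
Proof.
have ker_or (U : {vspace kev g}) : U = 0%VS \/ U = fullv.
  have [->|] := eqVneq U 0%VS; first by left.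
  rewrite -vpick0 => u0; right; apply/vspaceP => v; rewrite memvf.
  have -> : v = (v / vpick U : k) *: vpick U.
    by rewrite /GRing.scale /= mulfVK.
  by rewrite memvZ ?memv_pick.
move=> U U0; have [->|->] := ker_or U.
  exists fullv; rewrite add0v cap0v; split=> //.
  by split=> [a v _|x v _ _]; exact: memvf.
exists 0%VS; rewrite addv0 capv0; split=> //.
by split=> [a v|x v _]; rewrite !memv0 => /eqP ->; rewrite linear0.
Qed.
End Restriction.

(** * Subquotients cut out by an idempotent *)

(** Let e = i p be an even idempotent of M with image W.  Compressing the action
    of g to W gives an action as soon as e x e y e = e x y e, which is the case
    when the image of e is a submodule, and also when its kernel is one.  This
    realizes submodules and quotients at once. *)
Section Retract.
Variables (k : fieldType) (g : lieSuperalg k) (M : smod g) (W : vectType k).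
Variables (i : 'Hom(W, M)) (p : 'Hom(M, W)).
Hypothesis pi : cancel i p.
Hypothesis pi_even : forall a m, i (p (pr M a m)) = pr M a (i (p m)).
Hypothesis pi_act : forall x y w,
  p (act M x (i (p (act M y (i w))))) = p (act M x (act M y (i w))).

Definition retract_proj a : 'End(W) := (p \o pr M a \o i)%VF.
Lemma retract_projE a w : retract_proj a w = p (pr M a (i w)).
Proof. by rewrite !comp_lfunE. Qed.
Lemma retract_projI a w : i (retract_proj a w) = pr M a (i w).
Proof. by rewrite retract_projE pi_even pi. Qed.

Fact retract_projM a b w :
  retract_proj a (retract_proj b w) = if a == b then retract_proj b w else 0.
Proof.
rewrite retract_projE retract_projI (pr_gr_if _ (pr_gr _ _)) retract_projE.
by case: eqP; rewrite ?linear0.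
Qed.
Fact retract_projS w : retract_proj false w + retract_proj true w = w.
Proof. by rewrite !retract_projE -linearD /= pr_sum pi. Qed.
Definition retract_space := proj_superspace retract_projM retract_projS.

Lemma mem_retract a w : (w \in gr retract_space a) = (i w \in gr M a).
Proof.
rewrite (proj_mem retract_projM) gr_pr -retract_projI.
by rewrite (can_eq pi).
Qed.

Definition retract_act : 'Hom(g, 'End(retract_space)) :=
  linfun (fun x => (p \o act M x \o i)%VF : 'End(retract_space)).
Lemma retract_actE x w : retract_act x w = p (act M x (i w)).
Proof.
rewrite linfun_linE ?comp_lfunE ?comp_lfunE // => c y z.
by apply/lfunP => v; rewrite add_lfunE scale_lfunE !comp_lfunE !linearP
  add_lfunE scale_lfunE linearP.
Qed.

Lemma ip_gr a m : m \in gr M a -> i (p m) \in gr M a.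
Proof. by rewrite !gr_pr => /eqP {2}<-; rewrite pi_even. Qed.

Fact retract_act_gr a b x w : x \in gr g a -> w \in gr retract_space b ->
  retract_act x w \in gr retract_space (a (+) b).
Proof.
rewrite !mem_retract retract_actE => xa wb; apply: ip_gr; exact: act_gr.
Qed.
Fact retract_act_br a b x y w : x \in gr g a -> y \in gr g b ->
  retract_act (br g x y) w = retract_act x (retract_act y w)
    - (-1) ^+ (a && b) *: retract_act y (retract_act x w).
Proof.
move=> xa yb; rewrite !retract_actE !pi_act (act_br _ xa yb).
by rewrite linearB linearZ.
Qed.
Definition retract : smod g := Smod retract_act_gr retract_act_br.

Lemma retract_incl0 :
  (forall x m, x \in gr g false -> i (p (act M x m)) = act M x (i (p m))) ->
  @is_shom0 _ g retract M i.
Proof.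
move=> H; split=> [a w|x w xa]; first by rewrite mem_retract.
by rewrite retract_actE H // pi.
Qed.

Lemma retract_proj0 :
  (forall x m, x \in gr g false -> i (p (act M x m)) = act M x (i (p m))) ->
  @is_shom0 _ g M retract p.
Proof.
move=> H; split=> [a w|x w xa]; first by rewrite mem_retract; apply: ip_gr.
by rewrite retract_actE -H // pi.
Qed.
End Retract.

(** * Finitely many restrictions to the even part *)

Lemma daddv_pi0 (k : fieldType) (V : vectType k) (U W : {vspace V}) w :
  (U :&: W = 0)%VS -> w \in W -> daddv_pi U W w = 0.
Proof.
move=> UW wW; have := daddv_pi_add UW (subvP (addvSr U W) _ wW).
by rewrite (@daddv_pi_id _ _ W U) ?(capvC W) // => /(canRL (addrK _)); rewrite subrr.
Qed.

Lemma daddv_pi_sum (k : fieldType) (V : vectType k) (U W : {vspace V}) v :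
  (U + W = fullv)%VS -> (U :&: W = 0)%VS -> daddv_pi U W v + daddv_pi W U v = v.
Proof. by move=> UW UW0; rewrite daddv_pi_add ?UW ?memvf. Qed.

Lemma daddv_pi_comm (k : fieldType) (V : vectType k) (U W : {vspace V})
    (T : {linear V -> V}) v :
  (U + W = fullv)%VS -> (U :&: W = 0)%VS ->
  (forall u, u \in U -> T u \in U) -> (forall w, w \in W -> T w \in W) ->
  daddv_pi U W (T v) = T (daddv_pi U W v).
Proof.
move=> UW UW0 TU TW; rewrite -[v in LHS](daddv_pi_sum v UW UW0) !linearD /=.
by rewrite (daddv_pi0 UW0 (TW _ (memv_pi W U v))) daddv_pi_id ?addr0 // TU ?memv_pi.
Qed.

Section SubspaceMaps.
Variables (k : fieldType) (V : vectType k) (X : {vspace V}).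

Definition incl_sub : 'Hom(subvs_of X, V) := linfun vsval.
Definition proj_sub (e : 'End(V)) : 'Hom(V, subvs_of X) := (linfun (vsproj X) \o e)%VF.

Lemma incl_subE w : incl_sub w = vsval w. Proof. exact: lfunE. Qed.
Lemma proj_subE e v : proj_sub e v = vsproj X (e v).
Proof. by rewrite comp_lfunE lfunE. Qed.
Lemma incl_proj_sub (e : 'End(V)) v : e v \in X -> incl_sub (proj_sub e v) = e v.
Proof. by move=> ev; rewrite incl_subE proj_subE vsprojK. Qed.
Lemma proj_incl_sub (e : 'End(V)) : {in X, forall v, e v = v} -> cancel incl_sub (proj_sub e).
Proof. by move=> eX w; rewrite incl_subE proj_subE eX ?subvsP // vsvalK. Qed.
End SubspaceMaps.

Definition finite_upto (X : Type) (R : X -> X -> Prop) (C : X -> Prop) :=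
  exists (m : nat) (L : 'I_m -> X), forall x, C x -> exists i, R x (L i).

Lemma finite_upto_fin (X : Type) (R : X -> X -> Prop) (C : X -> Prop) (I : finType)
  (L : I -> X) : (forall x : X, C x -> exists i, R x (L i)) -> finite_upto R C.
Proof.
move=> H; exists #|I|, (fun i => L (enum_val i)) => x /H[i Ri].
by exists (enum_rank i); rewrite enum_rankK.
Qed.

Lemma finite_upto_bigcup (X : Type) (R : X -> X -> Prop) (I : finType) (D : I -> X -> Prop) :
  (forall i, finite_upto R (D i)) -> finite_upto R (fun x => exists i, D i x).
Proof.
move=> H; have [m Hm] := fin_all_exists H; have [L HL] := fin_all_exists Hm.
apply: (@finite_upto_fin _ _ _ {i : I & 'I_(m i)} (fun u => L (tag u) (tagged u))).
by move=> x [i /HL[j Rj]]; exists (Tagged (fun i => 'I_(m i)) j).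
Qed.

Section SimpleSubquotients.
Variables (k : fieldType) (g : lieSuperalg k).
Implicit Types M : smod g.

(** Descend from M to smaller and smaller nonzero submodules. *)
Lemma minimal_submod M : (fullv : {vspace M}) <> 0%VS ->
  exists U : {vspace M}, [/\ is_submod U, U <> 0%VS &
    forall V : {vspace M}, is_submod V -> (V <= U)%VS -> V = 0%VS \/ V = U].
Proof.
move=> M0; suff H d (U : {vspace M}) : (\dim U <= d)%N -> is_submod U -> U <> 0%VS ->
    exists U : {vspace M}, [/\ is_submod U, U <> 0%VS &
      forall V : {vspace M}, is_submod V -> (V <= U)%VS -> V = 0%VS \/ V = U].
  by apply: (H _ fullv (leqnn _)) => //; split=> [a v|x v] _; exact: memvf.
elim: d U => [|d IH] U dU smU U0.
  by case: U0; apply/eqP; rewrite -dimv_eq0 -leqn0.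
have [H|/not_all_ex_not[V VH]] :=
  classic (forall V : {vspace M}, is_submod V -> (V <= U)%VS -> V = 0%VS \/ V = U).
  by exists U.
have [smV /(imply_to_and (_ <= _)%VS)[VU /not_or_and[V0 nVU]]] := imply_to_and _ _ VH.
apply: (IH V) => //; rewrite -ltnS; apply: leq_trans dU.
by rewrite (ltn_leqif (dimv_leqif_eq VU)); apply/eqP.
Qed.

Lemma retract_simple M (X : {vspace M}) (W : vectType k) (i : 'Hom(W, M)) (p : 'Hom(M, W))
    pi pi_even pi_act (N := @retract k g M W i p pi pi_even pi_act) :
  (forall x w, i (p (act M x (i w))) = act M x (i w)) -> limg i = X -> X <> 0%VS ->
  (forall V : {vspace M}, is_submod V -> (V <= X)%VS -> V = 0%VS \/ V = X) ->
  is_simple N.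
Proof.
move=> ia iX X0 Xmin.
have ii : lker i == 0%VS by apply/lker0P/(can_inj pi).
split=> [N0|U [Ug Ua]]; first by apply: X0; rewrite -iX N0 limg0.
have [||iU0|iUX] := Xmin (i @: U)%VS.
- split=> [a _ /memv_imgP[u uU ->]|x _ /memv_imgP[u uU ->]].
    have := Ug a u uU; rewrite pr_proj => puU.
    by rewrite -(retract_projI pi pi_even) memv_img.
  have := Ua x u uU; rewrite /= retract_actE => puU.
  by rewrite -ia memv_img.
- by rewrite -iX limgS // subvf.
- left; apply/eqP; rewrite -subv0; apply/subvP => u uU; rewrite memv0.
  have : i u \in (i @: U)%VS by apply: memv_img.
  by rewrite iU0 memv0 -(inj_eq (can_inj pi)) linear0.
right; apply/vspaceP => u; rewrite memvf.
have : i u \in (i @: U)%VS by rewrite iUX -iX memv_img ?memvf.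
by case/memv_imgP => v vU /(can_inj pi) ->.
Qed.

(** A minimal submodule U has a complement W over g0, since M is in F.  Along
    the decomposition U + W, the submodule U is one retract of M and the
    quotient M / U, transported to W, is the other. *)
Lemma split_simple M : in_F M -> (fullv : {vspace M}) <> 0%VS ->
  exists S Q, [/\ [/\ in_F S, is_simple S & (\dim {:S} <= \dim {:M})%N],
    in_F Q, (\dim {:Q} < \dim {:M})%N & iso0 M (dsum S Q)].
Proof.
move=> FM M0; have [U [[Ug Ua] U0 Umin]] := minimal_submod M0.
have [W [[Wg Wa] UW UW0]] : exists W : {vspace M},
  [/\ is_submod0 W, (U + W = fullv)%VS & (U :&: W = 0)%VS].
  by apply: FM; split=> // x u _; apply: Ua.
have WU : (W + U = fullv)%VS by rewrite addvC.
have WU0 : (W :&: U = 0)%VS by rewrite capvC.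
pose e := daddv_pi U W; pose f := daddv_pi W U.
pose i1 := incl_sub U; pose p1 := proj_sub U e.
pose i2 := incl_sub W; pose p2 := proj_sub W f.
have ip1 m : i1 (p1 m) = e m by rewrite incl_proj_sub ?memv_pi.
have ip2 m : i2 (p2 m) = f m by rewrite incl_proj_sub ?memv_pi.
have pi1 : cancel i1 p1 by apply: proj_incl_sub => v vU; apply: daddv_pi_id.
have pi2 : cancel i2 p2 by apply: proj_incl_sub => v vU; apply: daddv_pi_id.
have i1U w : i1 w \in U by rewrite /i1 incl_subE subvsP.
have ef m : m = e m + f m by rewrite daddv_pi_sum.
have e_pr a m : i1 (p1 (pr M a m)) = pr M a (i1 (p1 m)).
  by rewrite !ip1; apply: daddv_pi_comm => // w; [apply: Ug | apply: Wg].
have f_pr a m : i2 (p2 (pr M a m)) = pr M a (i2 (p2 m)).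
  by rewrite !ip2; apply: daddv_pi_comm => // w; [apply: Wg | apply: Ug].
have e_act x m : x \in gr g false -> i1 (p1 (act M x m)) = act M x (i1 (p1 m)).
  by move=> xa; rewrite !ip1; apply: daddv_pi_comm => // w wU; [apply: Ua | apply: Wa].
have f_act x m : x \in gr g false -> i2 (p2 (act M x m)) = act M x (i2 (p2 m)).
  by move=> xa; rewrite !ip2; apply: daddv_pi_comm => // w wU; [apply: Wa | apply: Ua].
have a1 x w : i1 (p1 (act M x (i1 w))) = act M x (i1 w).
  by rewrite ip1 /e daddv_pi_id // Ua.
have act1 x y w : p1 (act M x (i1 (p1 (act M y (i1 w))))) = p1 (act M x (act M y (i1 w))).
  by rewrite a1.
have act2 x y w : p2 (act M x (i2 (p2 (act M y (i2 w))))) = p2 (act M x (act M y (i2 w))).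
  rewrite ip2; set v := act M y _; rewrite [v in RHS]ef !linearD /=.
  rewrite [X in X + _](_ : _ = 0) ?add0r //.
  apply: (can_inj pi2).
  by rewrite ip2 linear0 /f (daddv_pi0 WU0) // Ua // memv_pi.
pose S := retract pi1 e_pr act1; pose Q := retract pi2 f_pr act2.
have dU (X : {vspace M}) : \dim {:subvs_of X} = \dim X by rewrite dimvf.
exists S, Q; split.
- split; first exact: in_F_inj (retract_incl0 pi1 e_pr act1 e_act) (can_inj pi1) FM.
    apply: (retract_simple _ _ _ a1 _ U0 Umin); apply/vspaceP => u.
    apply/memv_imgP/idP => [[w _ ->] //|uU]; exists (p1 u); rewrite ?memvf // ip1.
    by rewrite /e daddv_pi_id.
  by rewrite dU dimvS // subvf.
- exact: in_F_inj (retract_incl0 pi2 f_pr act2 f_act) (can_inj pi2) FM.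
- rewrite dU -UW (dimv_disjoint_sum UW0) -[X in (X < _)%N]add0n ltn_add2r lt0n.
  by rewrite dimv_eq0; apply/eqP.
have [F FE] : exists F : 'Hom(M, dsum S Q), forall m, F m = (p1 m, p2 m).
  by apply: linear_hom => c u v; apply: injective_projections; rewrite /= linearP.
have [G GE] : exists G : 'Hom(dsum S Q, M), forall m, G m = i1 m.1 + i2 m.2.
  by apply: linear_hom => c [u u'] [v v']; rewrite /= !linearP scalerDr addrACA.
have [I1 I2] := retract_incl0 pi1 e_pr act1 e_act.
have [J1 J2] := retract_incl0 pi2 f_pr act2 f_act.
have [P1 P2] := retract_proj0 pi1 e_pr act1 e_act.
have [R1 R2] := retract_proj0 pi2 f_pr act2 f_act.
exists F, G; split.
- split=> [a m ma|x m xa]; rewrite !FE ?mem_dsum ?act_dsum.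
    by rewrite P1 ?R1.
  by rewrite P2 ?R2.
- split=> [a [u v]|x [u v] xa]; rewrite !GE ?mem_dsum ?act_dsum /=.
    by move=> /andP[/I1 ua /J1 va]; apply: memvD.
  by rewrite I2 // J2 // linearD.
- by move=> m; rewrite FE GE /= ip1 ip2 -ef.
move=> [u v]; rewrite GE FE /= !linearD /= pi1 pi2.
have -> : p1 (i2 v) = 0.
  apply: (can_inj pi1); rewrite ip1 linear0 /e (daddv_pi0 UW0) //.
  by rewrite /i2 incl_subE subvsP.
have -> : p2 (i1 u) = 0.
  by apply: (can_inj pi2); rewrite ip2 linear0 /f (daddv_pi0 WU0).
by rewrite addr0 add0r.
Qed.

(** Induction on the dimension: split off a simple submodule.  As only the
    isomorphism class of the simple module matters, it may be replaced by its
    representative. *)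
Lemma finite_restrictions n :
  finitely_many (fun S : smod g => [/\ in_F S, is_simple S & (\dim {:S} <= n)%N]) ->
  finite_upto (@iso0 k g) (fun M => in_F M /\ (\dim {:M} <= n)%N).
Proof.
move=> [m [L HL]].
suff H d : (d <= n)%N -> finite_upto (@iso0 k g) (fun M => in_F M /\ (\dim {:M} <= d)%N).
  exact: H.
elim: d => [|d IH] dn.
  have [[M0 [_ dM0]]|no] := classic (exists M : smod g, in_F M /\ (\dim {:M} <= 0)%N).
    exists 1, (fun=> M0) => M [_ dM]; exists ord0.
    by apply: iso0_dim0; apply/eqP; rewrite -leqn0.
  exists 0, (fun i : 'I_0 => kev g) => M HM; case: no; by exists M.
have [m' [L' HL']] := IH (ltnW dn).
apply: (@finite_upto_fin _ _ _ (('I_m * 'I_m') + 'I_m')%type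
  (fun u => match u with inl (i, j) => dsum (L i) (L' j) | inr j => L' j end)).
move=> M [FM dM]; have [M0|M0] := classic ((fullv : {vspace M}) = 0%VS).
  have [|j Mj] := HL' M; last by exists (inr j).
  by rewrite M0 dimv0.
have [S [Q [[FS sS dS] FQ dQ MSQ]]] := split_simple FM M0.
have [|i Si] := HL S; first by split=> //; apply: leq_trans dS (leq_trans dM dn).
have [|j Qj] := HL' Q; first by rewrite -ltnS (leq_trans dQ dM).
exists (inl (i, j)); apply: iso0_trans MSQ _.
exact: iso0_dsum (sisom_iso0 Si) Qj.
Qed.

End SimpleSubquotients.

(** * Rigidity of endotrivial modules *)

Lemma bilinear_hom (k : fieldType) (U V W : vectType k) (b : U -> V -> W) :
  (forall u, linear (b u)) -> (forall v, linear (b^~ v)) ->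
  exists F : 'Hom(U, 'Hom(V, W)), forall u v, F u v = b u v.
Proof.
move=> bl br; have [|F FE] := @linear_hom k U 'Hom(V, W) (fun u => linfun (b u)).
  move=> c u u'; apply/lfunP => v.
  by rewrite add_lfunE scale_lfunE !linfun_linE // br.
by exists F => u v; rewrite FE linfun_linE.
Qed.

Lemma hom_gr_ext (k : fieldType) (V : superspace k) (W : vectType k) (u v : 'Hom(V, W)) :
  (forall a x, x \in gr V a -> u x = v x) -> u = v.
Proof.
by move=> H; apply/lfunP => x; rewrite -[x]pr_sum !linearD /= !(H _ _ (pr_gr _ _)).
Qed.

Section Rigidity.
Variables (k : fieldType) (g : lieSuperalg k).
Implicit Types M N P Q : smod g.

(** The even relative 1-cochains of (g, g0) with values in End(V), as maps on
    all of g rather than on g1. *)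
Definition odd_cochain (V : superspace k) (a : 'Hom(g, 'End(V))) (phi : 'Hom(g, 'End(V))) :=
  [/\ forall x, x \in gr g false -> phi x = 0,
      forall x b m, x \in gr g true -> m \in gr V b -> phi x m \in gr V (~~ b) &
      forall x y m, x \in gr g false -> y \in gr g true ->
        phi (br g x y) m = a x (phi y m) - phi y (a x m)].

(** The coboundary of phi as a cochain with values in Hom(V, V), where the
    source carries the action a and the target the action a0.  Keeping the two
    apart serves to deform one of them while the other is fixed. *)
Definition cobound (V : superspace k) (a0 a phi : 'Hom(g, 'End(V))) x y m :=
  phi x (a y m) + a0 x (phi y m) + (phi y (a x m) + a0 y (phi x m)).

(** The first relative cohomology of End(V) vanishes in even degree. *)
Definition rigid (V : superspace k) (a : 'Hom(g, 'End(V))) :=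
  forall phi, odd_cochain a phi ->
    (forall x y m, x \in gr g true -> y \in gr g true -> cobound a a phi x y m = 0) ->
  exists2 f : 'End(V), evenf f & forall x m, phi x m = f (a x m) - a x (f m).

(** These are the conditions under which x (c, m) = (chi x m, x m) is an action
    of g on k_ev + Q that restricts to the direct sum action of g0. *)
Definition kev_cocycle Q (chi : 'Hom(g, 'Hom(Q, k^o))) :=
  [/\ forall x, x \in gr g false -> chi x = 0,
      forall x m, x \in gr g true -> m \in gr Q false -> chi x m = 0,
      forall x y m, x \in gr g false -> y \in gr g true ->
        chi (br g x y) m = - chi y (act Q x m) &
      forall x y m, x \in gr g true -> y \in gr g true ->
        chi x (act Q y m) + chi y (act Q x m) = 0].

Definition kev_coboundary Q (chi : 'Hom(g, 'Hom(Q, k^o))) :=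
  exists2 sg : 'Hom(Q, k^o), forall m, m \in gr Q true -> sg m = 0 &
    forall x m, chi x m = sg (act Q x m).

(** The extension E of P by k_ev defined by the cocycle has the same g0-action as
    the direct sum, so it is in F, and the identity of P lifts to E.  The first
    component of the lift is the required functional. *)
Lemma projective_kev_coboundary P (chi : 'Hom(g, 'Hom(P, k^o))) :
  projective P -> kev_cocycle chi -> kev_coboundary chi.
Proof.
move=> [FP Plift] [chi0 chie chi01 chi11].
pose V := dsum_space (kev g) P.
have [|u|T TE] := @bilinear_hom k g V V (fun x u => (chi x u.2, act P x u.2)).
- by move=> x c u v; apply: injective_projections; rewrite /= linearP.
- by move=> c x y; apply: injective_projections; rewrite /= linearP add_lfunE scale_lfunE.
have Tgr a b x m : x \in gr g a -> m \in gr V b -> T x m \in gr V (a (+) b).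
  case: m => c m xa; rewrite TE !mem_dsum => /andP[_ mb] /=.
  rewrite (act_gr xa mb) andbT.
  case: a b xa mb => [] [] xa mb /=; rewrite ?memvf // ?(chie _ _ xa mb) ?mem0v //.
  by rewrite chi0 // zero_lfunE mem0v.
have Tbr a b x y m : x \in gr g a -> y \in gr g b ->
    T (br g x y) m = T x (T y m) - (-1) ^+ (a && b) *: T y (T x m).
  case: m => c m xa yb; rewrite !TE /=; apply: injective_projections; last first.
    by rewrite /= (act_br _ xa yb).
  have xyab := br_gr xa yb; have anti := br_anti xa yb.
  case: a b xa yb xyab anti => [] [] xa yb xyab anti /=.
  - by rewrite chi0 // zero_lfunE expr1 scaleN1r opprK chi11.
  - rewrite anti /= scale1r linearN opp_lfunE chi01 // (chi0 y) // zero_lfunE.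
    by rewrite scaler0 subr0 opprK.
  - by rewrite chi01 // (chi0 x) // zero_lfunE scale1r add0r.
  by rewrite !chi0 // !zero_lfunE scaler0 subr0.
pose E : smod g := Smod Tgr Tbr.
have FE : in_F E.
  apply: (@in_F_inj _ _ (dsum (kev g) P) E (\1%VF : 'End(V)));
    last exact: in_F_dsum (@in_F_kev k g) FP.
  - split=> [a m|x [c m] xa]; rewrite !id_lfunE // act_dsum [LHS]TE /=.
    by rewrite chi0 // !zero_lfunE.
  - by move=> u v; rewrite !id_lfunE.
have [p pE] : exists p : 'Hom(E, P), forall m, p m = m.2 by exact: linear_hom.
have [|||h h_hom ph] := Plift E P p \1%VF FE FP.
- split=> [a [c m]|x [c m]]; rewrite !pE ?mem_dsum; first by case/andP.
  by rewrite /= TE.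
- apply/vspaceP => m; rewrite memvf; apply/memv_imgP.
  by exists (0, m); rewrite ?memvf ?pE.
- by split=> [a m|x m]; rewrite !id_lfunE.
have h2 m : (h m).2 = m by rewrite -pE -comp_lfunE ph id_lfunE.
have [sg sgE] : exists sg : 'Hom(P, k^o), forall m, sg m = (h m).1.
  by apply: linear_hom => c u v; rewrite linearP.
case: h_hom => he ha; exists sg => [m mo|x m].
  have := he _ _ mo; rewrite sgE; case: (h m) => c m'.
  by rewrite mem_dsum memv0 => /andP[/eqP].
by rewrite sgE ha /= TE h2.
Qed.

(** On the trivial summand a cocycle vanishes because of parity: an odd element
    of g sends the even line to the odd part of k_ev, which is zero. *)
Lemma split_kev_coboundary P Q (chi : 'Hom(g, 'Hom(Q, k^o))) :
  projective P -> sisom Q (dsum (kev g) P) -> kev_cocycle chi -> kev_coboundary chi.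
Proof.
move=> projP [f [h [[fe fa] [he ha] hf fh]]] [chi0 chie chi01 chi11].
have hfK m : h (f m) = m by rewrite -comp_lfunE hf id_lfunE.
have [i iE] : exists i : 'Hom(P, dsum (kev g) P), forall m, i m = (0, m).
  by apply: linear_hom => c u v; apply: injective_projections; rewrite /= ?scaler0 ?addr0.
have ie a m : m \in gr P a -> i m \in gr (dsum (kev g) P) a.
  by move=> ma; rewrite iE mem_dsum mem0v.
have ia x m : i (act P x m) = act (dsum (kev g) P) x (i m).
  by rewrite !iE act_dsum linear0.
have [||chiP chiPE] := @bilinear_hom k g P k^o (fun x m => chi x (h (i m))).
- by move=> x c u v; rewrite !linearP.
- by move=> m c x y; rewrite linearP add_lfunE scale_lfunE.
have [|sg sg1 sgE] := @projective_kev_coboundary P chiP projP.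
  split=> [x xa|x m xa ma|x y m xa ya|x y m xa ya].
  - by apply/lfunP => m; rewrite chiPE chi0 // !zero_lfunE.
  - by rewrite chiPE chie // he // ie.
  - by rewrite !chiPE chi01 // ia ha.
  - by rewrite !chiPE !ia !ha chi11.
have [p pE] : exists p : 'Hom(Q, P), forall m, p m = (f m).2.
  by apply: linear_hom => c u v; rewrite linearP.
exists (sg \o p)%VF => [m mo|x m]; rewrite comp_lfunE pE.
  have := fe _ _ mo; case: (f m) => c m'; rewrite mem_dsum => /andP[_ /sg1].
  by [].
rewrite fa; have := hfK m; case: (f m) => c m' <-.
rewrite act_dsum /= -sgE chiPE iE.
have -> : ((c, m') : dsum (kev g) P) = (c, 0) + (0, m').
  by apply: injective_projections; rewrite /= ?addr0 ?add0r.
rewrite !linearD /=; suff -> : chi x (h (c, 0)) = 0 by rewrite add0r.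
have c0 : h (c, 0) \in gr Q false by apply: he; rewrite mem_dsum memvf mem0v.
rewrite -[x]pr_sum linearD /= add_lfunE chi0 ?pr_gr // zero_lfunE add0r.
by rewrite chie ?pr_gr.
Qed.

(** The cocycle attached to phi sends x and m (x) xi to xi (phi x (par m)); the
    sign in [par] accounts for moving the odd map phi x past m.  The functional
    sg that splits it is of the form m (x) xi |-> xi (f0 m), and undoing the sign
    turns f0 into the endomorphism f with coboundary phi. *)
Lemma endotrivial_rigid M : endotrivial M -> rigid (act M).
Proof.
move=> [_ [P [projP isoP]]] phi [phi0 phi_gr phi01] phi11.
pose D := sdual M; pose Q := tensor M D.
have [ev [evE _]] := @tens_universal k M D k^o (fun v xi => (xi : dvec M) v)
  (fun xi => linearP xi) (fun v c xi xi' =>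
     etrans (add_lfunE _ _ v) (congr1 (+%R^~ _) (scale_lfunE _ _ v))).
have [||chi chiE] := @bilinear_hom k g Q k^o (fun x T => ev (tmap (phi x \o par M)%VF \1 T)).
- by move=> x c u v; rewrite !linearP.
- move=> T c x y; rewrite linearP comp_lfunDl -comp_lfunZl tmap_linearl.
  by rewrite add_lfunE scale_lfunE linearP.
have chip x b m (xi : D) : m \in gr M b ->
    chi x (tpure m xi) = (-1) ^+ b *: (xi : dvec M) (phi x m).
  by move=> mb; rewrite chiE tmapE evE id_lfunE comp_lfunE (par_gr mb) !linearZ.
have eqQ (u v : 'Hom(Q, k^o)) : (forall b c m xi, m \in gr M b -> xi \in gr D c ->
    u (tpure m xi) = v (tpure m xi)) -> forall T, u T = v T.
  by move=> H T; congr (fun_of_lfun _ T); apply: tens_gr_ext.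
have xi0 b c m (xi : D) : m \in gr M b -> xi \in gr D c -> b != c -> (xi : dvec M) m = 0.
  move=> mb xic bc; apply: (mem_dual _ _ xic).
  by have <- : b = ~~ c by case: (b) (c) bc => [] [].
have actQ a b x m (xi : D) : x \in gr g a -> m \in gr M b ->
    act Q x (tpure m xi) = tpure (act M x m) xi + (-1) ^+ (a && b) *: tpure m (act D x xi).
  by move=> xa mb; apply: tens_actE.
have actD a b x (xi : D) m : x \in gr g a -> xi \in gr D b ->
    (act D x xi : dvec M) m = - ((-1) ^+ (a && b) *: (xi : dvec M) (act M x m)).
  by move=> xa xib; apply: dual_actE.
have chi_coc : @kev_cocycle Q chi.
  split=> [x xa|x T xa|x y T xa ya|x y T xa ya].
  - apply/lfunP; apply: eqQ => b c m xi mb _.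
    by rewrite (chip _ _ _ _ mb) phi0 // !zero_lfunE linear0 scaler0.
  - rewrite (proj_mem (@tens_projM _ _ M D)) => /eqP <-.
    rewrite -comp_lfunE -[RHS](zero_lfunE _ T); move: T; apply: eqQ => b c m xi mb xic.
    rewrite comp_lfunE (tens_proj_pure _ mb xic) zero_lfunE.
    case: eqP => [bc|_]; last by rewrite linear0.
    rewrite (chip _ _ _ _ mb) (xi0 _ _ _ _ (phi_gr _ _ _ xa mb) xic) ?scaler0 //.
    by case: (b) (c) bc => [] [].
  - rewrite -comp_lfunE -opp_lfunE; move: T; apply: eqQ => b c m xi mb xic.
    rewrite opp_lfunE comp_lfunE (actQ _ _ _ _ _ xa mb) linearD linearZ /=.
    rewrite (chip _ _ _ _ (act_gr xa mb)) !(chip _ _ _ _ mb) phi01 //.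
    rewrite (actD _ _ _ _ _ xa xic) /= expr0 !scale1r linearB /=.
    by rewrite -scalerDr -scalerN opprB.
  rewrite -!comp_lfunE -add_lfunE -[RHS](zero_lfunE _ T); move: T; apply: eqQ => b c m xi mb xic.
  have E z t : z \in gr g true -> t \in gr g true -> chi z (act Q t (tpure m xi)) =
      - (-1) ^+ b *: (xi : dvec M) (phi z (act M t m) + act M t (phi z m)).
    move=> za ta; rewrite (actQ _ _ _ _ _ ta mb) linearD linearZ /=.
    rewrite (chip _ _ _ _ (act_gr ta mb)) !(chip _ _ _ _ mb) (actD _ _ _ _ _ ta xic) /=.
    rewrite linearD scalerDr /= signrN; congr (_ + _).
    have [<-|bc] := eqVneq b c.
      by rewrite scalerA -expr2 sqrr_sign scale1r scaleNr.
    have mb' : act M t (phi z m) \in gr M b.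
      by have := act_gr ta (phi_gr _ _ _ za mb); case: (b).
    by rewrite (xi0 _ _ _ _ mb' xic bc) !scaler0 oppr0 !scaler0.
  rewrite add_lfunE !comp_lfunE zero_lfunE !E // -scalerDr -linearD /=.
  have -> : phi x (act M y m) + act M y (phi x m) + (phi y (act M x m) + act M x (phi y m))
    = cobound (act M) (act M) phi x y m.
    by rewrite /cobound [LHS](AC (2*2)%AC (1*4*(3*2))%AC).
  by rewrite phi11 // linear0 scaler0.
have [sg sg1 sgE] := split_kev_coboundary projP isoP chi_coc.
(* dual bases of M and its dual, to read sg as an endomorphism *)
have [n [X [xs Xxs]]] : exists n (X : 'I_n -> M) (xs : 'I_n -> D),
    forall v, v = \sum_i (xs i : dvec M) v *: X i.
  have H i : exists xi : D, forall v, (xi : dvec M) v = coord (vbasis {:M}) i v.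
    by apply: (@linear_hom k M k^o) => c u v; rewrite linearP.
  have [xs xsE] := fin_all_exists H.
  exists _, (fun i => (vbasis {:M})`_i), xs => v.
  by rewrite [LHS](coord_vbasis (memvf v)); apply: eq_bigr => i _; rewrite xsE.
have [f0 f0E] : exists f0 : 'End(M), forall m, f0 m = \sum_i sg (tpure m (xs i)) *: X i.
  apply: linear_hom => c u v; rewrite scaler_sumr -big_split; apply: eq_bigr => i _ /=.
  by rewrite tpureDl tpureZl linearP scalerDl scalerA.
have xif0 m (xi : D) : (xi : dvec M) (f0 m) = sg (tpure m xi).
  have xiE : xi = \sum_i (xi : dvec M) (X i) *: xs i.
    apply/lfunP => v; rewrite sum_lfunE {1}(Xxs v) linear_sum.
    by apply: eq_bigr => i _; rewrite linearZ scale_lfunE /= /GRing.scale /= mulrC.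
  have [tm tmE] := linear_hom ((@tpure_bilinear k M D).2 m).
  rewrite f0E linear_sum {2}xiE -tmE !linear_sum /=; apply: eq_bigr => i _.
  by rewrite !linearZ /= tmE /GRing.scale /= mulrC.
have xi_eq u v : (forall c (xi : D), xi \in gr D c -> (xi : dvec M) u = (xi : dvec M) v) -> u = v.
  move=> H; rewrite (Xxs u) (Xxs v); apply: eq_bigr => i _; congr (_ *: _).
  by rewrite -(pr_sum (xs i)) !add_lfunE !(H _ _ (pr_gr _ _)).
have f0_gr : evenf f0.
  move=> b m mb; rewrite gr_pr; apply/eqP/xi_eq => c xi xic.
  have [bc|bc] := eqVneq b c; last first.
    rewrite (xi0 _ _ _ _ (pr_gr _ _) xic bc) xif0 sg1 //.
    have := mem_tens_pure mb xic.
    by have -> : b (+) c = true by case: (b) (c) bc => [] [].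
  have nbc : ~~ b != c by rewrite bc; case: (c).
  have := xi0 _ _ _ _ (pr_gr (~~ b) (f0 m)) xic nbc; move: (f0 m) => w w0.
  by rewrite -[w in RHS]pr_sum linearD /=; case: (b) w0 => -> /=; rewrite ?addr0 ?add0r.
(* For c of the parity of x m the two signs combine to (-1)^a; for the other
   parity of xi the term is zero. *)
have f0_act a b x m : x \in gr g a -> m \in gr M b ->
    (-1) ^+ b *: phi x m = f0 (act M x m) - (-1) ^+ a *: act M x (f0 m).
  move=> xa mb; apply: xi_eq => c xi xic.
  rewrite linearZ /= -(chip _ _ _ _ mb) sgE (actQ _ _ _ _ _ xa mb) linearD linearZ /=.
  rewrite -!xif0 (actD _ _ _ _ _ xa xic) linearB linearZ /=; congr (_ + _).
  rewrite !scalerN scalerA -signr_addb; congr (- _); rewrite [RHS]linearZ /=.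
  have [bc|bc] := eqVneq (a (+) b) c.
    by rewrite -bc; congr (_ *: _); congr (_ ^+ _); case: (a) (b) => [] [].
  by rewrite (xi0 _ _ _ _ (act_gr xa (f0_gr _ _ mb)) xic bc) !scaler0.
pose f : 'End(M) := (- (f0 \o par M))%VF.
have fE b m : m \in gr M b -> f m = - ((-1) ^+ b *: f0 m).
  by move=> mb; rewrite opp_lfunE comp_lfunE (par_gr mb) linearZ.
clearbody f; exists f => [b m mb|x m]; first by rewrite (fE b) // memvN memvZ // f0_gr.
have [||Psi PsiE] := @bilinear_hom k g M M (fun x m => f (act M x m) - act M x (f m)).
- by move=> y c u v; rewrite !linearP /= scalerDr addrACA.
- by move=> u c y z; rewrite !(linearP, add_lfunE, scale_lfunE) /= scalerDr addrACA.
rewrite -PsiE; suff -> : phi = Psi by [].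
apply: hom_gr_ext => a {}x xa; apply: hom_gr_ext => b {}m mb.
rewrite PsiE (fE _ _ (act_gr xa mb)) (fE _ _ mb).
have -> : act M x (- ((-1) ^+ b *: f0 m)) = - ((-1) ^+ b *: act M x (f0 m)).
  by rewrite linearN linearZ.
rewrite opprK; have -> : - ((-1) ^+ (a (+) b) *: f0 (act M x m)) + (-1) ^+ b *: act M x (f0 m)
    = - (-1) ^+ (a (+) b) *: (f0 (act M x m) - (-1) ^+ a *: act M x (f0 m)).
  rewrite scaleNr scalerBr opprB addrC scalerA -signr_addb; congr (_ *: _ + _).
  by case: (a) (b) => [] [].
rewrite -(f0_act _ _ _ _ xa mb) scalerA.
case: a xa => xa; last by rewrite phi0 // zero_lfunE scaler0.
by case: b mb => _ /=; rewrite ?expr0 ?expr1 ?opprK ?mulr1 ?mul1r ?mulN1r ?opprK scale1r.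
Qed.

End Rigidity.

(** * Module structures with a given restriction *)

(** [open_orbits] for linear maps, through matrices in chosen bases. *)
Lemma open_orbits_hom (k : fieldType) (E : Type) (C0 C1 C2 : vectType k) N
  (al be : E -> 'Hom(C0, C1)) (ga de : E -> 'Hom(C1, C2))
  (e : C0) (nu : {linear C0 -> 'M[k]_N}) :
  (forall x y u, (de x + ga y) ((be x + al y) u) = 0) ->
  (forall x w, (de x + ga x) w = 0 -> exists u, w = (be x + al x) u) ->
  (forall x, (be x + al x) e = 0) -> \det (nu e) != 0 ->
  exists t (L : 'I_t -> E), forall y, exists i u,
    (be (L i) + al y) u = 0 /\ \det (nu u) != 0.
Proof.
move=> dd ex de0 nue.
pose b0 := vbasis {:C0}; pose b1 := vbasis {:C1}; pose b2 := vbasis {:C2}.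
have B0 := vbasisP {:C0}; have B1 := vbasisP {:C1}; have B2 := vbasisP {:C2}.
have AE x y u : rVof b1 ((be x + al y) u) =
    rVof b0 u *m (mxof b0 b1 (be x) + mxof b0 b1 (al y)).
  by rewrite -linearD /= (rVof_app _ B0).
have BE x y w : rVof b2 ((de x + ga y) w) =
    rVof b1 w *m (mxof b1 b2 (de x) + mxof b1 b2 (ga y)).
  by rewrite -linearD /= (rVof_app _ B1).
have [|x w|x||t [L LP]] := @open_orbits k E _ _ _ N (fun x => mxof b0 b1 (al x))
  (fun x => mxof b0 b1 (be x)) (fun x => mxof b1 b2 (ga x)) (fun x => mxof b1 b2 (de x))
  (rVof b0 e) (nu \o vecof b0).
- move=> x y; apply/row_matrixP => i; rewrite row0 rowE mulmxA.
  rewrite -[delta_mx 0 i](vecofK B0) -AE -BE dd.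
  exact: linear0.
- rewrite -[w](vecofK B1) -BE => /eqP; rewrite (rVof_eq0 B2) => /eqP /ex [u ->].
  by exists (rVof b0 u); rewrite AE.
- by rewrite -AE de0 linear0.
- by rewrite /= (rVofK B0).
exists t, L => y; have [i [v [v0 nuv]]] := LP y; exists i, (vecof b0 v); split=> //.
by apply/eqP; rewrite -(rVof_eq0 B1) AE (vecofK B0) v0.
Qed.

(** In finite dimension any set of vectors closed under linear combinations is
    the set of vectors of a subspace, by [finite_spanning]. *)
Lemma vspace_of_pred (k : fieldType) (V : vectType k) (P : V -> Prop) :
  P 0 -> (forall c u v, P u -> P v -> P (c *: u + v)) ->
  exists U : {vspace V}, forall v, v \in U <-> P v.
Proof.
move=> P0 Plin; have [t [L LP]] := finite_spanning (fun x : {v | P v} => sval x).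
exists <<map_tuple sval L>>%VS => v; split=> [/coord_span -> | Pv].
  elim/big_ind: _ => // [u w Pu Pw|i _]; first by rewrite -[u]scale1r; apply: Plin.
  rewrite -[_ *: _]addr0; apply: Plin => //.
  by rewrite -tnth_nth tnth_map; apply: proj2_sig.
exact: LP (exist _ v Pv).
Qed.

Section Bilinear.
Variables (k : fieldType) (U V W : vectType k).

Definition lin2 (b : U -> V -> W) : 'Hom(U, 'Hom(V, W)) := linfun (fun u => linfun (b u)).
Lemma lin2E b : (forall u, linear (b u)) -> (forall v, linear (b^~ v)) ->
  forall u v, lin2 b u v = b u v.
Proof.
move=> bl br u v; rewrite linfun_linE ?linfun_linE // => c p q.
by apply/lfunP => w; rewrite add_lfunE scale_lfunE !linfun_linE // br.
Qed.
End Bilinear.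

Lemma lin3E (k : fieldType) (X U V W : vectType k) (b : X -> U -> V -> W) :
  (forall x u, linear (b x u)) -> (forall x v, linear (fun u => b x u v)) ->
  (forall u v, linear (fun x => b x u v)) ->
  forall x u v, linfun (fun x => lin2 (b x)) x u v = b x u v.
Proof.
move=> H1 H2 H3 x u v; rewrite linfun_linE ?lin2E // => c p q.
apply/lfunP => y; rewrite add_lfunE scale_lfunE; apply/lfunP => z.
by rewrite add_lfunE scale_lfunE !lin2E // H3.
Qed.

Lemma sisom_trans (k : fieldType) (g : lieSuperalg k) (M N P : smod g) :
  sisom M N -> sisom N P -> sisom M P.
Proof.
move=> [f [h [[fe fa] [he ha] hf fh]]] [f' [h' [[fe' fa'] [he' ha'] hf' fh']]].
exists (f' \o f)%VF, (h \o h')%VF; split.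
- by split=> [a m /fe/fe'|x m]; rewrite !comp_lfunE // fa fa'.
- by split=> [a m /he'/he|x m]; rewrite !comp_lfunE // ha' ha.
- by rewrite -comp_lfunA (comp_lfunA h') hf' comp_lfun1l.
- by rewrite -comp_lfunA (comp_lfunA f) fh comp_lfun1l.
Qed.

Section FixedRestriction.
Variables (k : fieldType) (g : lieSuperalg k) (T : smod g).
Implicit Types (a : 'Hom(g, 'End(T))) (f : 'End(T)).

Definition extends_restriction a :=
  [/\ forall b c x m, x \in gr g b -> m \in gr T c -> a x m \in gr T (b (+) c),
      forall b c x y m, x \in gr g b -> y \in gr g c ->
        a (br g x y) m = a x (a y m) - (-1) ^+ (b && c) *: a y (a x m) &
      forall x, x \in gr g false -> a x = act T x].

Lemma extension_gr a : extends_restriction a ->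
  forall b c x m, x \in gr g b -> m \in gr T c -> a x m \in gr T (b (+) c).
Proof. by case. Qed.

Lemma extension_br a : extends_restriction a ->
  forall b c x y m, x \in gr g b -> y \in gr g c ->
    a (br g x y) m = a x (a y m) - (-1) ^+ (b && c) *: a y (a x m).
Proof. by case. Qed.

Definition smod_of a (Ha : extends_restriction a) : smod g :=
  Smod (extension_gr Ha) (extension_br Ha).

(** The differential in degree 0 of the complex of [cobound] sends f to f a - a0 f,
    and in degree 1 it is the sum of a part that involves only a and a part that
    involves only a0.  Each part is packaged as a linear map. *)
Definition rmul a : 'Hom('End(T), 'Hom(g, 'End(T))) := lin2 (fun f x => (f \o a x)%VF).
Definition lmul a : 'Hom('End(T), 'Hom(g, 'End(T))) := lin2 (fun f x => (a x \o f)%VF).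

Lemma rmulE a f x m : rmul a f x m = f (a x m).
Proof.
rewrite lin2E ?comp_lfunE // => [h c y z|y c h h']; apply/lfunP => v;
  by rewrite !(comp_lfunE, add_lfunE, scale_lfunE, linearP).
Qed.
Lemma lmulE a f x m : lmul a f x m = a x (f m).
Proof.
rewrite lin2E ?comp_lfunE // => [h c y z|y c h h']; apply/lfunP => v;
  by rewrite !(comp_lfunE, add_lfunE, scale_lfunE, linearP).
Qed.

Let p1 (x : g) := pr g true x.
Definition cob_r a : 'Hom('Hom(g, 'End(T)), 'Hom(g, 'Hom(g, 'End(T)))) :=
  linfun (fun phi : 'Hom(g, 'End(T)) =>
    lin2 (fun x y : g => (phi (p1 x) \o a (p1 y))%VF + (phi (p1 y) \o a (p1 x))%VF)).
Definition cob_l a : 'Hom('Hom(g, 'End(T)), 'Hom(g, 'Hom(g, 'End(T)))) :=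
  linfun (fun phi : 'Hom(g, 'End(T)) =>
    lin2 (fun x y : g => (a (p1 x) \o phi (p1 y))%VF + (a (p1 y) \o phi (p1 x))%VF)).

Lemma cob_rE a phi x y m :
  cob_r a phi x y m = phi (p1 x) (a (p1 y) m) + phi (p1 y) (a (p1 x) m).
Proof.
rewrite lin3E ?add_lfunE ?comp_lfunE // => [h z c u v|h z c u v|z z' c h h']; apply/lfunP => w;
  rewrite /p1 !(comp_lfunE, add_lfunE, scale_lfunE, linearP);
  by rewrite scalerDr addrACA.
Qed.
Lemma cob_lE a phi x y m :
  cob_l a phi x y m = a (p1 x) (phi (p1 y) m) + a (p1 y) (phi (p1 x) m).
Proof.
rewrite lin3E ?add_lfunE ?comp_lfunE // => [h z c u v|h z c u v|z z' c h h']; apply/lfunP => w;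
  rewrite /p1 !(comp_lfunE, add_lfunE, scale_lfunE, linearP);
  by rewrite scalerDr addrACA.
Qed.

Lemma cobE a0 a phi x y m : (cob_l a0 phi + cob_r a phi) x y m =
  cobound a0 a phi (pr g true x) (pr g true y) m.
Proof.
do 3!rewrite add_lfunE; rewrite cob_lE cob_rE /cobound.
by rewrite [LHS](AC (2*2)%AC (3*1*(4*2))%AC).
Qed.

Lemma commE a0 a f x m : (rmul a f - lmul a0 f) x m = f (a x m) - a0 x (f m).
Proof. by do 2!rewrite add_lfunE opp_lfunE; rewrite rmulE lmulE. Qed.

Lemma odd_cochain_res a phi : extends_restriction a ->
  odd_cochain a phi <-> odd_cochain (act T) phi.
Proof.
move=> [_ _ aT]; split=> -[H0 H1 H2]; split=> // x y m xa ya.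
  by rewrite H2 // aT.
by rewrite H2 // aT.
Qed.

Definition rigid_ext a := extends_restriction a /\ rigid a.

(** The complex of [open_orbits_hom] consists of the even g0-endomorphisms of T,
    the odd cochains, and the bilinear maps from pairs of odd elements of g to
    End(T); these spaces depend only on the action of g0 on T.  The 0-cocycle to
    be deformed is the identity, and the condition on the determinant makes the
    deformed cocycle invertible. *)
Lemma rigid_ext_cover : exists t (L : 'I_t -> {a | rigid_ext a}),
  forall a, rigid_ext a -> exists i f,
    [/\ evenf f, forall x m, f (a x m) = sval (L i) x (f m) & lker f == 0%VS].
Proof.
have [D DP] : exists D : {vspace 'End(T)}, forall f, f \in D <->
    (evenf f /\ forall x m, x \in gr g false -> f (act T x m) = act T x (f m)).
  apply: vspace_of_pred => [|c u v [ue ua] [ve va]].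
    by split=> [b m|x m] _; rewrite !zero_lfunE ?mem0v ?linear0.
  split=> [b m mb|x m xa]; rewrite !(add_lfunE, scale_lfunE).
    by rewrite memvD ?memvZ ?ue ?ve.
  by rewrite ua // va // linearP.
have [Z ZP] : exists Z : {vspace 'Hom(g, 'End(T))}, forall phi, phi \in Z <->
    odd_cochain (act T) phi.
  apply: vspace_of_pred => [|c u v [u0 u1 u2] [v0 v1 v2]].
    by split=> [x xa|x b m _ _|x y m _ _]; rewrite !zero_lfunE ?mem0v ?linear0 ?addr0.
  split=> [x xa|x b m xa mb|x y m xa ya]; rewrite !(add_lfunE, scale_lfunE).
  - by rewrite u0 // v0 // scaler0 addr0.
  - by rewrite memvD ?memvZ ?u1 ?v1.
  by rewrite u2 // v2 // linearP scalerBr opprD addrACA.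
pose E := {a | rigid_ext a}.
pose piZ : 'Hom('Hom(g, 'End(T)), subvs_of Z) := linfun (vsproj Z).
pose al (x : E) := (piZ \o rmul (sval x) \o incl_sub D)%VF.
pose be (x : E) := - (piZ \o lmul (sval x) \o incl_sub D)%VF.
pose ga (x : E) := (cob_r (sval x) \o incl_sub Z)%VF.
pose de (x : E) := (cob_l (sval x) \o incl_sub Z)%VF.
(* f y - x f is a cochain because f commutes with the common action of g0 *)
have commZ (x y : E) f : f \in D -> rmul (sval y) f - lmul (sval x) f \in Z.
  case: x y => [a [[agr abr aT] _]] [b [[bgr bbr bT] _]] /= /DP[fe fa].
  apply/ZP; split=> [z za|z c m za mc|z t m za ta].
  - apply/lfunP => m; rewrite commE bT // aT // fa //.
    by rewrite zero_lfunE subrr.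
  - rewrite commE memvB //.
      exact: fe _ _ (bgr _ _ _ _ za mc).
    exact: agr _ _ _ _ za (fe _ _ mc).
  rewrite !commE (abr _ _ _ _ _ za ta) (bbr _ _ _ _ _ za ta).
  rewrite /= expr0 !scale1r (aT z) // (bT z) // !linearB /= !fa //.
  exact: addrACA.
have dE (x y : E) u : vsval ((be x + al y) u) =
    rmul (sval y) (vsval u) - lmul (sval x) (vsval u).
  rewrite add_lfunE opp_lfunE !comp_lfunE !incl_subE addrC -linearB /= lfunE.
  by rewrite vsprojK // commZ ?subvsP.
have gE (x y : E) w : (de x + ga y) w = cob_l (sval x) (vsval w) + cob_r (sval y) (vsval w).
  by rewrite add_lfunE !comp_lfunE incl_subE.
have D1 : \1%VF \in D.
  by apply/DP; split=> [b m|x m _]; rewrite !id_lfunE.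
pose nu (u : subvs_of D) := mxof (vbasis {:T}) (vbasis {:T}) (vsval u).
have nu_lin : linear nu by move=> c u v; rewrite /nu !linearP.
pose nuL : {linear subvs_of D -> 'M[k]__} := HB.pack nu (GRing.isLinear.Build _ _ _ _ nu nu_lin).
have [|x w w0|x||t [L LP]] := @open_orbits_hom k E _ _ _ _ al be ga de (vsproj D \1%VF) nuL.
- move=> x y u; rewrite gE dE; have [] := (proj2_sig x, proj2_sig y).
  move: (sval x) (sval y) (vsval u) (subvsP u) => a b f /DP[fe fa].
  move=> [[_ abr aT] _] [[_ bbr bT] _].
  apply/lfunP => z; apply/lfunP => t; apply/lfunP => m.
  rewrite cobE !zero_lfunE /cobound !commE !linearB /= !subrKA.
  have z1 := pr_gr true z; have t1 := pr_gr true t; have zt0 := br_gr z1 t1.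
  have := fa _ m zt0; rewrite -{1}(bT _ zt0) -(aT _ zt0).
  rewrite (abr _ _ _ _ _ z1 t1) (bbr _ _ _ _ _ z1 t1) /= expr1 !scaleN1r !opprK !linearD /=.
  by move=> e; rewrite addrACA -opprD e subrr.
- case: x w0 => a [aext arig] w0.
  have [z t m za ta|f fe fE] := arig (vsval w) ((odd_cochain_res _ aext).2 ((ZP _).1 (subvsP w))) _.
    have := w0; rewrite gE => /lfunP/(_ z)/lfunP/(_ t)/lfunP/(_ m).
    by rewrite cobE !pr_id // !zero_lfunE.
  have fD : f \in D.
    case: (aext) => _ _ aT; apply/DP; split=> // x m xa.
    have [w0' _ _] := (ZP _).1 (subvsP w).
    by have := fE x m; rewrite w0' // zero_lfunE aT // => /esym/eqP; rewrite subr_eq0 => /eqP.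
  exists (vsproj D f); apply: subvs_inj; rewrite dE vsprojK //=.
  by apply/lfunP => z; apply/lfunP => m; rewrite fE commE.
- apply: subvs_inj; rewrite dE linear0 vsprojK //; apply/lfunP => z; apply/lfunP => m.
  by rewrite commE !id_lfunE subrr !zero_lfunE.
- by rewrite /= /nu vsprojK // mxof1 ?det1 ?oner_eq0 // (basis_free (vbasisP _)).
exists t, L => a Ha; have [i [u [u0 nuu]]] := LP (exist _ a Ha).
exists i, (vsval u); have [fe fa] := (DP _).1 (subvsP u); split=> // [x m|].
  have := congr1 vsval u0; rewrite dE linear0 => /lfunP/(_ x)/lfunP/(_ m).
  rewrite commE !zero_lfunE => /eqP.
  by rewrite subr_eq0 => /eqP.
rewrite -subv0; apply/subvP => m; rewrite memv_ker memv0 => /eqP fm.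
rewrite -(rVof_eq0 (vbasisP {:T})); apply/eqP.
have nuu' : mxof (vbasis {:T}) (vbasis {:T}) (vsval u) \in unitmx.
  by rewrite unitmxE unitfE.
apply: (can_inj (mulmxK nuu')); rewrite -(rVof_app _ (vbasisP _)) fm.
by rewrite mul0mx linear0.
Qed.

Lemma smod_of_isom a a' f (Ha : extends_restriction a) (Ha' : extends_restriction a') :
  evenf f -> (forall x m, f (a x m) = a' x (f m)) -> lker f == 0%VS ->
  sisom (smod_of Ha) (smod_of Ha').
Proof.
move=> fe fa f0; have fK := lker0_lfunK f0; have fVK := lker0_lfunVK f0.
exists f, (f^-1)%VF; split; [by [] | | exact: lker0_compVf | exact: lker0_compfV].
split=> [b m|x m]; last by apply: (can_inj fK); rewrite fVK fa fVK.
by rewrite !gr_pr => /eqP {2}<-; rewrite -{2}(fVK m) -(even_pr _ _ fe) fK.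
Qed.

(** Conjugation by the g0-isomorphism M -> T carries both the action of g and the
    cochains over to T. *)
Lemma transport_restriction M : iso0 M T -> rigid (act M) ->
  exists a (Ha : extends_restriction a), rigid a /\ sisom M (smod_of Ha).
Proof.
move=> [u [h [[ue ua] [he ha] uK hK]]] rM.
have [||a aE] := @bilinear_hom k g T T (fun x m => u (act M x (h m))).
- by move=> x c m m'; rewrite !linearP.
- by move=> m c x y; rewrite linearP add_lfunE scale_lfunE linearP.
have Ha : extends_restriction a.
  split=> [b c x m xb mc|b c x y m xb yc|x xa].
  - by rewrite aE; apply/ue/act_gr => //; apply: he.
  - by rewrite !aE !uK (act_br _ xb yc) linearB linearZ.
  by apply/lfunP => m; rewrite aE ua // hK.
exists a, Ha; split; last first.
  exists u, h; split; last 2 first.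
  - by apply/lfunP => m; rewrite comp_lfunE id_lfunE uK.
  - by apply/lfunP => m; rewrite comp_lfunE id_lfunE hK.
  - by split=> // x m; rewrite /= aE uK.
  by split=> // x m; rewrite /= aE uK.
move=> phi [phi0 phi1 phi2] phi11.
have [||psi psiE] := @bilinear_hom k g M M (fun x m => h (phi x (u m))).
- by move=> x c m m'; rewrite !linearP.
- by move=> m c x y; rewrite linearP add_lfunE scale_lfunE linearP.
have hu x m : act M x m = h (a x (u m)) by rewrite aE !uK.
have [|x y m xa ya|f fe fE] := rM psi.
- split=> [x xa|x b m xa mb|x y m xa ya].
  + by apply/lfunP => m; rewrite psiE phi0 // !zero_lfunE linear0.
  + by rewrite psiE; apply/he/phi1 => //; apply: ue.
  by rewrite !psiE phi2 // !hu !hK linearB.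
- have := congr1 h (phi11 x y (u m) xa ya).
  by rewrite /cobound !linearD linear0 /= !psiE !hu !hK.
have [f' f'E] : exists f' : 'End(T), forall m, f' m = u (f (h m)).
  by apply: linear_hom => c m m'; rewrite !linearP.
exists f' => [b m mb|x m]; first by rewrite f'E; apply/ue/fe/he.
by rewrite !f'E -{1}[m]hK -[LHS]hK -psiE fE linearB /= !hu !hK.
Qed.

Lemma finite_fixed_restriction :
  finite_upto (@sisom k g) (fun M => rigid (act M) /\ iso0 M T).
Proof.
have [t [L HL]] := rigid_ext_cover.
exists t, (fun i => smod_of (proj2_sig (L i)).1) => M [rM MT].
have [a [Ha [ra Ma]]] := transport_restriction MT rM.
have [i [f [fe fa f0]]] := HL a (conj Ha ra); exists i.
exact: sisom_trans Ma (smod_of_isom _ _ fe fa f0).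
Qed.

End FixedRestriction.

Theorem theorem7p1 (k : closedFieldType) (char0 : [pchar k] =i pred0)
  (n : nat) (g : lieSuperalg k) (g_classical : classical g)
  (fin_simple : finitely_many
    (fun S : smod g => [/\ in_F S, is_simple S & (\dim {:S} <= n)%N])) :
  finitely_many (fun M : smod g => endotrivial M /\ \dim {:M} = n).
Proof.
have [m [T HT]] := finite_restrictions fin_simple.
have [m' [L HL]] := finite_upto_bigcup (fun i => finite_fixed_restriction (T i)).
exists m', L => M [endoM dM]; apply: HL.
have [|i MTi] := HT M; first by split; [case: endoM | rewrite dM].
by exists i; split=> //; apply: endotrivial_rigid.
Qed.
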